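(* The trivial solution $u\equiv0$ is locally stable for all $\lambda\in(0,\lambda_1)$ and unstable for all $\lambda\in(\lambda_1,\infty)$, where $\lambda_1$ is the smallest of the roots $\lambda_n$ of the characteristic equations $$\frac{\varepsilon n^2\pi^2}{\lambda^2}=-\ddot W^*(1/\lambda),\qquad n=1,2,\ldots,$$ i.e. $(\lambda_1,0)$ is the first bifurcation point.
   Context: Let $W\in C^3(0,\infty)$ satisfy: $W(F)\nearrow\infty$ as $F\searrow0$; $W(F)\nearrow\gamma>0$ as $F\nearrow\infty$; $W(1)=0$ and $W(F)>0$ for $F\ne1$; $W$ is strictly convex on $(0,1/\kappa)$ and strictly concave on $(1/\kappa,\infty)$, where $0<\kappa<1$. Define $W^*(H)=HW(1/H)$ for $H>0$, $W^*(0)=0$, $W^*(H)=+\infty$ for $H<0$. Dots denote derivatives with respect to the argument. Then $W^*\in C^3(0,\infty)$, $W^*(1)=0$, $W^*>0$ on $(0,\infty)\setminus\{1\}$, $\dot W^*(0^+)=\gamma$, and $W^*$ is strictly concave on $[0,\kappa)$ and strictly convex on $(\kappa,\infty)$. The constant $\varepsilon>0$ is fixed. $\mathcal H=\{v\in H^1(0,1):\int_0^1 v\,ds=0\}$ is the Hilbert space with inner product $\langle u,v\rangle=\int_0^1u'v'\,ds$, and $\mathcal K=\{v\in\mathcal H: v\ge-1\text{ on }[0,1]\}$. The potential energy is $$V_\varepsilon[\lambda,u]=\int_0^1\Big[\tfrac{\varepsilon}{2}(u')^2+\lambda^4W^*\big([1+u]/\lambda\big)\Big]ds,\qquad u\in\mathcal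 K .$$ An equilibrium is a solution $u\in\mathcal K$ of $\int_0^1[\varepsilon u'(v-u)'+\lambda^3\dot W^*([1+u]/\lambda)(v-u)]ds\ge0$ for all $v\in\mathcal K$; $u\equiv0$ is an equilibrium for every $\lambda>0$. An equilibrium is locally stable if it renders $V_\varepsilon[\lambda,\cdot]$ a local minimum (in the topology of $\mathcal H$), and unstable if $V_\varepsilon[\lambda,\cdot]$ has neither a local nor a global minimum there. The shape of the graph of $\ddot W^*$ is such that for each $n\in\mathbb N$ the characteristic equation $\frac{\varepsilon n^2\pi^2}{\lambda^2}=-\ddot W^*(1/\lambda)$ has exactly one root $\lambda=\lambda_n>0$, which is simple and transversal (the two sides, as functions of $1/\lambda$, cross with different slopes), and $1/\kappa<\lambda_1<\lambda_2<\cdots$. *)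

(* Defs.v *)
From HB Require Import structures.
From mathcomp Require Import all_boot all_order all_algebra.
From mathcomp Require Import all_classical all_reals all_analysis.

Set Implicit Arguments.
Unset Strict Implicit.
Unset Printing Implicit Defensive.

Import Order.TTheory GRing.Theory Num.Theory.
Import numFieldNormedType.Exports.

Local Open Scope ring_scope.
Local Open Scope classical_set_scope.

Section StoredEnergy.
Context {R : realType}.
Implicit Types (W f : R -> R) (D : set R).

Definition strictly_convex_on D f : Prop :=
  forall x y t : R, D x -> D y -> x != y -> 0 < t -> t < 1 ->
    f (t * x + (1 - t) * y) < t * f x + (1 - t) * f y.

Definition strictly_concave_on D f : Prop :=
  strictly_convex_on D (fun x => - f x).

Definition C3_pos f : Prop :=
  (forall (k : nat) (x : R), (k < 3)%N -> 0 < x -> derivable (f^`(k)) x 1) /\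
  (forall x : R, 0 < x -> {for x, continuous (f^`(3))}).

(* [W_zero_mono] and [W_infty_mono] are the monotonicity carried by the arrows
   in "W(F) increases to +oo as F decreases to 0" and "W(F) increases to gam
   as F increases to +oo". *)
Record stored_energy W (gam kap : R) : Prop := StoredEnergy {
  W_gam_gt0 : 0 < gam ;
  W_kap_gt0 : 0 < kap ;
  W_kap_lt1 : kap < 1 ;
  W_C3 : C3_pos W ;
  W_zero_cvg : W x @[x --> 0^'+] --> +oo ;
  W_zero_mono : exists2 d : R, 0 < d &
    forall x y : R, 0 < x -> x <= y -> y < d -> W y <= W x ;
  W_infty_cvg : W x @[x --> +oo] --> gam ;
  W_infty_mono : exists M : R, forall x y : R, M < x -> x <= y -> W x <= W y ;
  W_one : W 1 = 0 ;
  W_pos : forall x : R, 0 < x -> x != 1 -> 0 < W x ;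
  W_convex : strictly_convex_on `]0, kap^-1[ W ;
  W_concave : strictly_concave_on `]kap^-1, +oo[ W
}.

Definition Wstar W (H : R) : \bar R :=
  if 0 < H then (H * W H^-1)%:E else if H == 0 then 0%:E else +oo%E.

Definition Wstarr W : R -> R := fine \o Wstar W.

(* The value at H = 0 is the one-sided limit, needed since 1 + u may vanish
   for admissible u; negative H never occur. *)
Definition dWstar W (H : R) : R :=
  if 0 < H then (Wstarr W)^`()%classic H
  else lim ((Wstarr W)^`()%classic h @[h --> 0^'+]).

Definition char_eq (eps : R) W (n : nat) (lam : R) : Prop :=
  eps * n%:R ^+ 2 * pi ^+ 2 / lam ^+ 2 = - (Wstarr W)^`(2)%classic lam^-1.

(* Both sides of the characteristic equation are viewed as functions of
   h = 1/lam. *)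
Definition char_transversal (eps : R) W (n : nat) (lam : R) : Prop :=
  (fun h : R => eps * n%:R ^+ 2 * pi ^+ 2 * h ^+ 2)^`()%classic lam^-1 <>
  (fun h : R => - (Wstarr W)^`(2)%classic h)^`()%classic lam^-1.

End StoredEnergy.

Section Space.
Context {R : realType}.
Implicit Types (u v g phi : R -> R).

Notation mu := (@lebesgue_measure R).

Definition square_integrable g : Prop :=
  measurable_fun `](0 : R), 1[ g /\
  mu.-integrable `](0 : R), 1[ (fun s => (g s ^+ 2)%:E).

Definition test_function phi : Prop :=
  [/\ forall x : R, derivable phi x 1,
      continuous (phi^`()) &
      exists a b : R, [/\ 0 < a, b < 1 &
        forall x : R, x \notin `[a, b] -> phi x = 0]].

Definition weak_derivative u g : Prop :=
  square_integrable g /\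
  forall phi, test_function phi ->
    \int[mu]_(s in `]0, 1[) (u s * phi^`()%classic s) =
    - \int[mu]_(s in `]0, 1[) (g s * phi s).

(* Elements of H^1(0,1) are given by their continuous representatives on
   [0, 1]; the values of u outside [0, 1] are irrelevant. *)
Definition H1 u : Prop :=
  [/\ {within `[0, 1], continuous u}, square_integrable u &
      exists g, weak_derivative u g].

(* A representative of the weak derivative, unique up to null sets. *)
Definition wderiv u : R -> R := get [set g | weak_derivative u g].

Definition HH u : Prop := H1 u /\ \int[mu]_(s in `[0, 1]) u s = 0.

Definition HH_inner u v : R :=
  \int[mu]_(s in `[0, 1]) (wderiv u s * wderiv v s).

Definition HH_norm u : R := Num.sqrt (HH_inner u u).

Definition KK u : Prop := HH u /\ forall s : R, s \in `[0, 1] -> -1 <= u s.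

End Space.

Section Energy.
Context {R : realType}.
Variables (eps : R) (W : R -> R).
Implicit Types (u v : R -> R) (lam : R).

Notation mu := (@lebesgue_measure R).

Definition energy lam u : \bar R :=
  (\int[mu]_(s in `[0%R, 1%R])
     ((eps / 2 * wderiv u s ^+ 2)%:E
      + (lam ^+ 4)%:E * Wstar W ((1 + u s) / lam)))%E.

Definition equilibrium lam u : Prop :=
  KK u /\
  forall v, KK v ->
    0 <= \int[mu]_(s in `[0, 1])
           (eps * wderiv u s * wderiv (v \- u) s
            + lam ^+ 3 * dWstar W ((1 + u s) / lam) * (v s - u s)).

Definition local_minimum lam u : Prop :=
  exists2 d : R, 0 < d &
    forall v, KK v -> HH_norm (v \- u) < d -> (energy lam u <= energy lam v)%E.

Definition global_minimum lam u : Prop :=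
  forall v, KK v -> (energy lam u <= energy lam v)%E.

Definition locally_stable lam u : Prop :=
  equilibrium lam u /\ local_minimum lam u.

Definition unstable lam u : Prop :=
  [/\ equilibrium lam u, ~ local_minimum lam u & ~ global_minimum lam u].

(* (lam0, 0) is a limit point of equilibria (lam, u) with u <> 0. *)
Definition bifurcation_point (lam0 : R) : Prop :=
  0 < lam0 /\
  forall d : R, 0 < d -> exists lam u,
    [/\ 0 < lam, `|lam - lam0| < d, equilibrium lam u, HH_norm u < d &
        exists2 s : R, s \in `[0, 1] & u s != 0].

Definition first_bifurcation_point (lam0 : R) : Prop :=
  bifurcation_point lam0 /\
  forall lam' : R, bifurcation_point lam' -> lam0 <= lam'.

End Energy.

(* Main.v *)
Require Import Defs.
From HB Require Import structures.
From mathcomp Require Import all_boot all_order all_algebra.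
From mathcomp Require Import all_classical all_reals all_analysis.
From mathcomp Require Import measurable_realfun ring lra.

(** Write V for W* as a real function and h = 1/lambda, so that the argument
    (1 + u)/lambda of W* is h + h u.

    Stability is decided by the number
      stiffness h = eps pi^2 h^2 + V''(h),
    which up to the factor lambda^2/2 is the second variation of the energy at 0
    along cos (pi s).  Its zeros are the inverse roots of the first
    characteristic equation, so h1 = 1/lambda_1 is the only one.  For large h
    the stiffness is positive, since W is convex near 0 and therefore V'' >= 0
    beyond kappa; transversality makes the zero h1 simple, so the sign changes
    there and lambda < lambda_1 is the region of positive stiffness
    ([simple_zero_signs], [stiffness_signs]).

    In one dimension the norm of H^1 controls the sup norm ([HH_sup_bound]), so
    near 0 the potential can be expanded pointwise to second order, and its
    linear term integrates to 0 because deformations have mean zero.  What is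
    left is compared with the gradient term by the sharp inequality
    pi^2 int v^2 <= int v'^2 ([neumann_poincare]).  With positive stiffness this
    makes 0 a local minimum ([stable_of_stiffness]) and, applied to the
    variational inequality tested against v = 0, excludes small nonzero
    equilibria for all nearby lambda ([no_small_equilibrium]), so no bifurcation
    occurs before lambda_1.  With negative stiffness, t cos (pi s) lowers the
    energy for every small t ([not_minimum_of_stiffness]).

    The existence of a bifurcation at lambda_1 is obtained by solving the
    equilibrium equation explicitly.  A monotone equilibrium H = (1 + u)/lambda
    running from a = c - r to b = c + r satisfies
      eps H'^2 = 2 lambda^2 (V(H) - L(H)),  L the chord of V over [a, b],
    since the multiplier of the mean constraint is the slope of the chord.
    Put H = c - r cos theta and let Q be minus the second divided difference
    of V at a, b and H; then V - L = r^2 sin^2(theta) Q and the equation becomes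
    d theta/ds = (lambda/sqrt eps) sqrt (2 Q), which is regular at both ends.
    Reaching theta = pi at s = 1 fixes lambda, and then the mean-zero condition is
      Phi(c, r) = int_0^pi (c - r cos theta) / sqrt (2 Q) d theta = 1/sqrt eps
    ([quadrature_equilibrium]).  For r -> 0 one has 2 Q -> -V''(c), so Phi tends
    to pi c/sqrt (-V''(c)), and Phi is below or above 1/sqrt eps according to
    the sign of the stiffness at c.  As that sign changes at h1 and Phi is
    continuous in c, each small r admits a centre c close to h1 solving the
    equation ([small_orbit_exists]); the resulting equilibria are nonzero, have
    amplitude of order r and lambda close to lambda_1 ([bifurcation_of_signs]). *)

Set Implicit Arguments.
Unset Strict Implicit.
Unset Printing Implicit Defensive.

Import Order.TTheory GRing.Theory Num.Theory.
Import numFieldNormedType.Exports.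

Local Open Scope ring_scope.
Local Open Scope classical_set_scope.

(** * Calculus on the line *)

Section Calculus.
Context {R : realType}.
Implicit Types (f g F q : R -> R) (a b x y z lo hi : R).
Notation mu := (@lebesgue_measure R).

Lemma is_derive_continuous f x l : is_derive x 1 f l -> {for x, continuous f}.
Proof.
move=> [df _]; apply: differentiable_continuous; exact/derivable1_diffP.
Qed.

Lemma is_derive_val f x l : is_derive x 1 f l -> f^`()%classic x = l.
Proof. by move=> h; rewrite derive1E derive_val. Qed.

Lemma is_derive_within f F a b : (forall x, a <= x <= b -> is_derive x 1 F (f x)) ->
  {within `[a, b], continuous F}.
Proof.
move=> h; apply: derivable_within_continuous => x.
by rewrite in_itv /= => /h [].
Qed.

Lemma continuous_within f (A : set R) : continuous f -> {within A, continuous f}.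
Proof. by move=> cf; apply: continuous_subspaceT. Qed.

(** The two sign conditions say that z lies between x and y in either order, which
    avoids a case distinction each time the lemma is used. *)
Lemma mvt_between f f1 lo hi x y :
  (forall z, lo < z < hi -> is_derive z 1 f (f1 z)) ->
  lo < x < hi -> lo < y < hi ->
  exists z, [/\ lo < z < hi, 0 <= (z - x) * (y - x), 0 <= (y - z) * (y - x) &
     f y - f x = f1 z * (y - x)].
Proof.
move=> df; wlog xy : x y / x <= y => [hw|] xI yI.
  have [xy|/ltW yx] := leP x y; first exact: hw.
  have [z [zI z1 z2 e]] := hw y x yx yI xI.
  exists z; split => //; [by lra|by lra|].
  by rewrite -opprB e; ring.
have [c] := @MVT_segment _ f f1 x y xy
      (fun t (ht : t \in `]x, y[%R) => df t ltac:(move: ht yI xI; rewrite in_itv /=; lra))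
      (@is_derive_within f1 f x y (fun t ht => df t ltac:(move: ht yI xI; lra))).
rewrite in_itv /= => /andP[xc cy] e.
by exists c; split => //; [lra|nra|nra].
Qed.

(** Two applications of the mean value theorem to f minus its quadratic model give
    a remainder (f2 t - m) (z - x) (y - x) with z between x and y, hence a
    product of nonnegative factors whichever side of x the point y lies on. *)
Lemma taylor2_ge f f1 f2 lo hi m x y :
  (forall z, lo < z < hi -> is_derive z 1 f (f1 z)) ->
  (forall z, lo < z < hi -> is_derive z 1 f1 (f2 z)) ->
  (forall z, lo < z < hi -> m <= f2 z) ->
  lo < x < hi -> lo < y < hi ->
  f x + f1 x * (y - x) + m / 2 * (y - x) ^+ 2 <= f y.
Proof.
move=> df df1 hm xI yI.
(* D is f minus its quadratic model at x, up to the constant f x; D1 is its derivative *)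
pose D1 z := f1 z - f1 x - m * (z - x).
pose D z := f z - f1 x * (z - x) - m / 2 * (z - x) ^+ 2.
have dD z : lo < z < hi -> is_derive z 1 D (D1 z).
  move=> zI; have := df _ zI => h.
  apply: is_derive_eq; rewrite /D1 /GRing.scale /=; lra.
have dD1 z : lo < z < hi -> is_derive z 1 D1 (f2 z - m).
  move=> zI; have := df1 _ zI => h.
  apply: is_derive_eq; rewrite /GRing.scale /=; lra.
have [z [zI z1 _ ez]] := mvt_between dD xI yI.
have [t [tI _ _ et]] := mvt_between dD1 xI zI.
have := hm _ tI.
have D1x : D1 x = 0 by rewrite /D1; ring.
rewrite D1x subr0 in et; rewrite et in ez.
rewrite /D in ez => mt.
suff : 0 <= D y - D x by rewrite /D; lra.
by rewrite /D ez -mulrA mulr_ge0 // subr_ge0.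
Qed.

Lemma taylor2_le f f1 f2 lo hi m x y :
  (forall z, lo < z < hi -> is_derive z 1 f (f1 z)) ->
  (forall z, lo < z < hi -> is_derive z 1 f1 (f2 z)) ->
  (forall z, lo < z < hi -> f2 z <= m) ->
  lo < x < hi -> lo < y < hi ->
  f y <= f x + f1 x * (y - x) + m / 2 * (y - x) ^+ 2.
Proof.
move=> df df1 hm xI yI.
have := @taylor2_ge (fun z => - f z) (fun z => - f1 z) (fun z => - f2 z)
  lo hi (- m) x y.
have h1 z : lo < z < hi -> is_derive z 1 (fun z => - f z) (- f1 z).
  by move=> /df h; apply: is_deriveN.
have h2 z : lo < z < hi -> is_derive z 1 (fun z => - f1 z) (- f2 z).
  by move=> /df1 h; apply: is_deriveN.
move=> /(_ h1 h2) h; have {h} := h _ xI yI.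
have h3 z : lo < z < hi -> - m <= - f2 z by move=> /hm; lra.
by move=> /(_ h3); lra.
Qed.

Lemma continuous_integrable_cc q a b : continuous q ->
  mu.-integrable `[a, b] (EFin \o q).
Proof.
move=> cq; apply: continuous_compact_integrable; first exact: segment_compact.
exact: continuous_within.
Qed.

Lemma Rintegral_base_change q a b x : continuous q -> a <= b -> b <= x ->
  \int[mu]_(t in `[a, x]) q t = \int[mu]_(t in `[a, b]) q t + \int[mu]_(t in `[b, x]) q t.
Proof.
move=> cq ab bx.
have := @Rintegral_itvB R q (BLeft a) (BRight x) b (continuous_integrable_cc _ _ cq).
rewrite !bnd_simp => /(_ ab bx) e.
rewrite -(@Rintegral_itv_obnd_cbnd R b (BRight x)); last first.
  apply: integrableS (continuous_integrable_cc b x cq) => //.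
  exact: subset_itv_oc_cc.
by rewrite -e; ring.
Qed.

(** An integral from a base point is differentiable only to the right of it, so
    the base point - |x| - 1 moves with x; by additivity the difference of two
    such integrals does not depend on it. *)
Lemma continuous_primitive q : continuous q ->
  exists F, forall x, is_derive x 1 F (q x).
Proof.
move=> cq.
pose I a x := \int[mu]_(t in `[a, x]) q t.
pose F x := I (- `|x| - 1) x - I (- `|x| - 1) 0.
exists F => x.
pose a := - `|x| - 2.
have FE y : - `|x| - 1 < y < `|x| + 1 -> F y = I a y - I a 0.
  move=> yI; rewrite /F /I.
  have hy : `|y| < `|x| + 1 by rewrite ltr_norml; lra.
  have := normr_ge0 y; have := normr_ge0 x; have := ler_norm (- y); have := ler_norm y.
  rewrite normrN => h1 h2 h3 h4.
  rewrite (@Rintegral_base_change q a (- `|y| - 1) y)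
    ?(@Rintegral_base_change q a (- `|y| - 1) 0) // /a; lra.
have xI : - `|x| - 1 < x < `|x| + 1.
  have := ler_norm (- x); have := ler_norm x; rewrite normrN; lra.
have [|||dI eI] := @continuous_FTC1_closed R q a x (x + 1) _ (continuous_integrable_cc _ _ cq).
- lra.
- rewrite /a; lra.
- exact: cq.
have dG : is_derive x 1 (fun y => I a y - I a 0) (q x).
  have h : is_derive x 1 (fun y => I a y) (q x).
    by split; [exact: dI|rewrite -derive1E].
  by apply: is_derive_eq; rewrite subr0.
apply: near_eq_is_derive dG.
near=> y; apply/esym/FE.
by apply/andP; split; near: y; [apply: lt_nbhsr|apply: lt_nbhsl]; lra.
Unshelve. all: by end_near. Qed.

Lemma FTC2 F q a b : (forall x, is_derive x 1 F (q x)) -> continuous q -> a <= b ->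
  \int[mu]_(t in `[a, b]) q t = F b - F a.
Proof.
move=> dF cq; rewrite le_eqVlt => /orP[/eqP ->|ab].
  by rewrite set_itv1 Rintegral_set1 subrr.
rewrite /Rintegral (@continuous_FTC2 _ q F) //.
- exact: continuous_within.
- split; first by move=> x _; case: (dF x).
  + by apply: cvg_at_right_filter; exact: (is_derive_continuous (dF a)).
  + by apply: cvg_at_left_filter; exact: (is_derive_continuous (dF b)).
- by move=> x _; exact: is_derive_val.
Qed.

End Calculus.

(** * Integration over the open unit interval *)

Section UnitInterval.
Context {R : realType}.
Implicit Types (f g h u v F q : R -> R) (a b x y : R).
Notation mu := (@lebesgue_measure R).
Local Notation I01 := (`](0 : R), 1[%classic).

Definition itg01 f : Prop := mu.-integrable I01 (EFin \o f).
Definition int01 f : R := \int[mu]_(s in I01) f s.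

Let mI : measurable (I01 : set (measurableTypeR R)).
Proof. exact: measurable_itv. Qed.

Lemma mu01 : mu I01 = 1%E.
Proof. by rewrite lebesgue_measure_itv /= lte_fin ltr01 -EFinB subr0. Qed.

Lemma itg01_measurable f : itg01 f -> measurable_fun I01 f.
Proof. by move=> /measurable_int /measurable_EFinP. Qed.

Lemma itg01_eq f g : (forall s, 0 < s < 1 -> f s = g s) -> itg01 f -> itg01 g.
Proof.
move=> fg; apply: eq_integrable => // s.
by rewrite inE /= in_itv /= => /fg ->.
Qed.

Lemma itg01D f g : itg01 f -> itg01 g -> itg01 (fun s => f s + g s).
Proof. by move=> fi gi; exact: (integrableD mI fi gi). Qed.

Lemma itg01B f g : itg01 f -> itg01 g -> itg01 (fun s => f s - g s).
Proof. by move=> fi gi; exact: (integrableB mI fi gi). Qed.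

Lemma itg01Z k f : itg01 f -> itg01 (fun s => k * f s).
Proof. by move=> fi; exact: (integrableZl mI k fi). Qed.

Lemma itg01_norm f : itg01 f -> itg01 (fun s => `|f s|).
Proof. by move=> fi; exact: (integrable_norm fi). Qed.

Lemma itg01_cst k : itg01 (fun=> k).
Proof.
apply: measurable_bounded_integrable => //; first by rewrite [X in (X < _)%E]mu01 ltry.
by exists `|k|; split => // M kM s _; exact: ltW.
Qed.

Lemma itg01_le f g : measurable_fun I01 f ->
  (forall s, 0 < s < 1 -> `|f s| <= g s) -> itg01 g -> itg01 f.
Proof.
move=> mf fg; apply: le_integrable => //; first exact/measurable_EFinP.
move=> s; rewrite /= in_itv /= => /fg; rewrite lee_fin => h.
by rewrite (le_trans h) // ler_norm.
Qed.

Lemma itg01_mul_bounded C g f : measurable_fun I01 g ->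
  (forall s, 0 < s < 1 -> `|g s| <= C) -> itg01 f -> itg01 (fun s => g s * f s).
Proof.
move=> mg gC fi; apply: (@itg01_le _ (fun s => C * `|f s|)).
- by apply: measurable_funM => //; exact: itg01_measurable.
- by move=> s /gC h; rewrite normrM ler_wpM2r.
- exact/itg01Z/itg01_norm.
Qed.

Lemma int01_eq f g : (forall s, 0 < s < 1 -> f s = g s) -> int01 f = int01 g.
Proof.
move=> fg; apply: eq_Rintegral => s.
by rewrite inE /= in_itv /= => /fg ->.
Qed.

Lemma int01D f g : itg01 f -> itg01 g ->
  int01 (fun s => f s + g s) = int01 f + int01 g.
Proof. by move=> fi gi; exact: (RintegralD mI fi gi). Qed.

Lemma int01B f g : itg01 f -> itg01 g ->
  int01 (fun s => f s - g s) = int01 f - int01 g.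
Proof. by move=> fi gi; exact: (RintegralB mI fi gi). Qed.

Lemma int01Z k f : itg01 f -> int01 (fun s => k * f s) = k * int01 f.
Proof. by move=> fi; exact: (RintegralZl k mI fi). Qed.

Lemma int01_cst k : int01 (fun=> k) = k.
Proof. by rewrite /int01 Rintegral_cst // [X in fine X]mu01 mulr1. Qed.

Lemma int01_ge0 f : (forall s, 0 < s < 1 -> 0 <= f s) -> 0 <= int01 f.
Proof. by move=> h; apply: Rintegral_ge0 => s /=; rewrite in_itv /= => /h. Qed.

Lemma int01_le f g : itg01 f -> itg01 g ->
  (forall s, 0 < s < 1 -> f s <= g s) -> int01 f <= int01 g.
Proof.
by move=> fi gi h; apply: le_Rintegral => // s /=; rewrite in_itv /= => /h.
Qed.

Lemma int01_norm f : itg01 f -> `|int01 f| <= int01 (fun s => `|f s|).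
Proof. by move=> fi; exact: le_normr_Rintegral. Qed.

Lemma int01_ae f g : measurable_fun I01 f -> measurable_fun I01 g ->
  ae_eq mu I01 f g -> int01 f = int01 g.
Proof.
move=> mf mg fg; congr fine; apply: ae_eq_integral => //; try exact/measurable_EFinP.
by apply: filterS fg => s /= h /h ->.
Qed.

(** The integrals of the problem are taken over the closed interval, whereas
    weak derivatives are measurable on the open one only. *)
Lemma Rintegral_cc_oo f : measurable_fun I01 f ->
  \int[mu]_(s in `[0, 1]) f s = int01 f.
Proof.
move=> mf; rewrite /int01 /Rintegral integral_itv_bndoo //.
exact/measurable_EFinP.
Qed.

Lemma int01_dct (f_ : nat -> R -> R) f g :
  (forall n, measurable_fun I01 (f_ n)) ->
  (forall s, 0 < s < 1 -> f_ n s @[n --> \oo] --> f s) ->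
  itg01 g -> (forall n s, 0 < s < 1 -> `|f_ n s| <= g s) ->
  int01 (f_ n) @[n --> \oo] --> int01 f.
Proof.
move=> mf ff gi fg.
have mf' n : measurable_fun I01 (EFin \o f_ n) by exact/measurable_EFinP.
have ff' s : I01 s -> (EFin \o f_ n) s @[n --> \oo] --> (EFin \o f) s.
  rewrite /= in_itv /= => /ff h; apply: cvg_EFin; [exact: nearW|exact: h].
have fg' n s : I01 s -> (`|(EFin \o f_ n) s| <= (EFin \o g) s)%E.
  by rewrite /= in_itv /= lee_fin; exact: fg.
have mf0 : measurable_fun I01 (EFin \o f) by exact: (emeasurable_fun_cvg _ _ mf' ff').
have [||fi _] := dominated_convergence mI mf' mf0 _ gi _.
- by apply: aeW => s; exact: ff'.
- by apply: aeW => s n; exact: fg'.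
rewrite -[X in _ --> X -> _]fineK; last exact: integrable_fin_num.
exact: fine_cvg.
Qed.

Lemma sqi_mul f g : square_integrable f -> square_integrable g ->
  itg01 (fun s => f s * g s).
Proof.
move=> [mf fi] [mg gi]; apply: (itg01_le _ _ (itg01D fi gi)).
- exact: measurable_funM.
- by move=> s _; rewrite normrM -(real_normK (num_real (f s))) -(real_normK (num_real (g s))); nra.
Qed.

Lemma sqi_cst k : square_integrable (fun=> k : R).
Proof. by split => //; exact: itg01_cst. Qed.

Lemma sqi_itg f : square_integrable f -> itg01 f.
Proof.
move=> fi; apply: itg01_eq (sqi_mul fi (sqi_cst 1)) => s _; exact: mulr1.
Qed.

Lemma sqiD f g : square_integrable f -> square_integrable g ->
  square_integrable (fun s => f s + g s).
Proof.
move=> hf hg; have [mf fi] := hf; have [mg gi] := hg; split.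
  exact: measurable_funD.
apply: itg01_eq (itg01D (itg01D fi gi) (itg01Z 2 (sqi_mul hf hg))) => s _ /=; ring.
Qed.

Lemma sqiZ k f : square_integrable f -> square_integrable (fun s => k * f s).
Proof.
move=> [mf fi]; split; first exact: measurable_funM.
by apply: itg01_eq (itg01Z (k ^+ 2) fi) => s _ /=; ring.
Qed.

Lemma sqiB f g : square_integrable f -> square_integrable g ->
  square_integrable (fun s => f s - g s).
Proof.
move=> hf hg; rewrite (_ : (fun s => _) = (fun s => f s + -1 * g s)).
  exact/sqiD/sqiZ.
by apply/funext => s; rewrite mulN1r.
Qed.

(** Cauchy-Schwarz against the constant 1, from the nonnegativity of the integral
    of (|f| - m)^2 with m the mean of |f|. *)
Lemma int01_sqr_ge f : square_integrable f ->
  int01 (fun s => `|f s|) ^+ 2 <= int01 (fun s => f s ^+ 2).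
Proof.
move=> hf; have fi := itg01_norm (sqi_itg hf); have [_ f2] := hf.
set m := int01 (fun s => `|f s|).
have : 0 <= int01 (fun s => (f s ^+ 2 - 2 * m * `|f s|) + m ^+ 2).
  apply: int01_ge0 => s _; have := sqr_ge0 (`|f s| - m).
  by rewrite -(real_normK (num_real (f s))); nra.
have i1 : itg01 (fun s => 2 * m * `|f s|) := itg01Z _ fi.
have i2 := itg01B f2 i1.
rewrite (int01D i2 (itg01_cst _)) (int01B f2 i1) (int01Z _ fi) int01_cst -/m.
by move=> h; rewrite -subr_ge0 (le_trans h) //; lra.
Qed.

Lemma measurable_continuous q (D : set R) : continuous q -> measurable_fun D q.
Proof.
by move=> cq; apply: measurable_funTS; exact: continuous_measurable_fun.
Qed.

Lemma continuous_bounded01 q : continuous q ->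
  exists2 C, 0 <= C & forall s, 0 <= s <= 1 -> `|q s| <= C.
Proof.
move=> cq; have cn : continuous (fun s => `|q s|).
  by move=> x; apply: cvg_norm; exact: cq.
have [c _ hc] := EVT_max ler01 (continuous_within cn).
by exists `|q c| => // s sI; apply: hc; rewrite in_itv.
Qed.

Lemma continuous_itg01 q : continuous q -> itg01 q.
Proof.
move=> cq; have [C _ hC] := continuous_bounded01 cq.
apply: (itg01_le _ _ (itg01_cst C)); first exact: measurable_continuous.
by move=> s sI; apply: hC; lra.
Qed.

Lemma continuous_sqr q : continuous q -> continuous (fun s => q s ^+ 2).
Proof. by move=> cq x; apply: cvgM; exact: cq. Qed.

Lemma continuous_sqi q : continuous q -> square_integrable q.
Proof.
move=> cq; split; first exact: measurable_continuous.
by apply: (@continuous_itg01 (fun s => q s ^+ 2)); exact: continuous_sqr.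
Qed.

Lemma FTC01 F q : (forall x, is_derive x 1 F (q x)) -> continuous q ->
  int01 q = F 1 - F 0.
Proof.
move=> dF cq; rewrite -(FTC2 dF cq ler01) Rintegral_cc_oo //.
exact: measurable_continuous.
Qed.

(** Composing with the retraction of the line onto [0, 1] yields a representative
    that is continuous everywhere, for which global calculus applies. *)
Lemma within_extend u : {within `[0, 1], continuous u} ->
  exists2 U : R -> R, continuous U & forall s, 0 <= s <= 1 -> U s = u s.
Proof.
move=> /subspace_continuousP cu.
pose cl (s : R) := Num.max 0 (Num.min s 1).
have clI s : `[0, 1]%classic (cl s).
  by rewrite /= in_itv /= /cl /Num.max /Num.min; case: ifP; case: ifP; lra.
have ccl : continuous cl.
  move=> s; apply: (@continuous_max R R (fun=> 0) (fun s => Num.min s 1)).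
    exact: cst_continuous.
  apply: (@continuous_min R R id (fun=> 1)); [exact: id|exact: cst_continuous].
exists (u \o cl).
  move=> s; apply: (@cvg_comp _ _ _ cl u _ (within `[0, 1]%classic (nbhs (cl s)))); last exact: cu.
  move=> A wA; have /(_ _ wA) h := ccl s.
  change (nbhs s (cl @^-1` A)); change (nbhs s (cl @^-1` (fun t => `[0, 1]%classic t -> A t))) in h.
  by apply: filterS h => t; apply; exact: clI.
move=> t tI /=; congr u; rewrite /cl /Num.max /Num.min; case: ifP; case: ifP; lra.
Qed.

Lemma within_sqi u : {within `[0, 1], continuous u} -> square_integrable u.
Proof.
move=> /within_extend [U cU Uu]; have [mU Ui] := continuous_sqi cU; split.
- apply: eq_measurable_fun mU => s; rewrite inE /= in_itv /= => sI.
  by apply: Uu; lra.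
- apply: (itg01_eq _ Ui) => s sI; rewrite Uu //; lra.
Qed.

Lemma continuous_closure_le q (m : R) : continuous q ->
  (forall s, 0 < s < 1 -> q s <= m) -> forall s, 0 <= s <= 1 -> q s <= m.
Proof.
move=> cq hq s sI; rewrite leNgt; apply/negP => qs.
have nr : \forall t \near s, m < q t by exact: (cvgr_gt (q s) (cq s) m qs).
move/nbhs_ballP : nr => [e /= e0 he].
(* a point of the open interval close to s, even if s is an endpoint *)
pose k := Num.min (e / 2) 2^-1.
have k0 : 0 < k <= 2^-1 by rewrite /k /Num.min; case: ifP; lra.
have ke : k <= e / 2 by rewrite /k /Num.min; case: ifP; lra.
have tI : 0 < (1 - k) * s + k / 2 < 1 by apply/andP; split; nra.
have /he : ball s e ((1 - k) * s + k / 2).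
  by rewrite /ball /= ltr_norml; apply/andP; split; nra.
by rewrite ltNge => /negP; apply; exact: hq.
Qed.

(** A primitive of q^2 is nondecreasing with equal values at 0 and 1, hence
    constant, so its derivative vanishes inside. *)
Lemma continuous_int01_sqr0 q : continuous q -> int01 (fun s => q s ^+ 2) = 0 ->
  forall s, 0 <= s <= 1 -> q s = 0.
Proof.
move=> cq q0; have [F dF] := continuous_primitive (continuous_sqr cq).
have := FTC01 dF (continuous_sqr cq); rewrite q0 => F01.
have mono x y : x <= y -> F x <= F y.
  move=> xy; rewrite -subr_ge0 -(FTC2 dF (continuous_sqr cq) xy).
  by apply: Rintegral_ge0 => s _; exact: sqr_ge0.
have Fc s : 0 < s < 1 -> q s = 0.
  move=> sI; have : is_derive s 1 F 0.
    apply: near_eq_is_derive (is_derive_cst (F 0) s 1).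
    near=> t; have tI : 0 < t < 1.
      by apply/andP; split; near: t; [apply: lt_nbhsr|apply: lt_nbhsl]; lra.
    by have := mono 0 t; have := mono t 1; rewrite /cst; lra.
  move=> /is_derive_val; rewrite (is_derive_val (dF s)) => /eqP.
  by rewrite sqrf_eq0 => /eqP.
have q2 s : 0 < s < 1 -> q s ^+ 2 <= 0 by move=> /Fc ->; rewrite expr0n.
move=> s sI; apply/eqP; rewrite -sqrf_eq0 eq_le sqr_ge0 andbT.
exact: (continuous_closure_le (continuous_sqr cq) q2).
Unshelve. all: by end_near. Qed.

End UnitInterval.

(** * Weak derivatives *)

Section WeakDerivative.
Context {R : realType}.
Implicit Types (f g h u v w F q p : R -> R) (a b x y s t z : R).

Lemma is_derive_affine f a b x l : is_derive (a * x + b) 1 f l ->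
  is_derive x 1 (fun s => f (a * s + b)) (a * l).
Proof.
move=> df; have dg : is_derive x 1 (fun s : R => a * s + b) a.
  by apply: is_derive_eq; rewrite /GRing.scale /=; lra.
by have := @is_derive1_comp R f (fun s : R => a * s + b) x l a df dg; rewrite mulrC.
Qed.

Lemma continuous_affine f a b : continuous f -> continuous (fun s => f (a * s + b)).
Proof.
move=> cf x; apply: (@continuous_comp _ _ _ (fun s : R => a * s + b) f); last exact: cf.
by apply: cvgD; [apply: cvgMl_tmp; exact: cvg_id|exact: cvg_cst].
Qed.

(** The normalised primitive of max (0, t (1 - t)).  Defining the step through its
    derivative makes it C^1 without any matching of pieces at 0 and 1. *)
Lemma smooth_step : exists S s' : R -> R,
  [/\ forall t, is_derive t 1 S (s' t), continuous s',
      forall t, (t <= 0 -> S t = 0) /\ (1 <= t -> S t = 1),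
      forall t, 0 <= S t <= 1 & forall t, 0 <= s' t /\ (~ (0 < t < 1) -> s' t = 0)].
Proof.
pose q (t : R) := Num.max 0 (t * (1 - t)).
have cq : continuous q.
  move=> t; apply: (@continuous_max R R (fun=> 0) (fun t => t * (1 - t))).
    exact: cst_continuous.
  by apply: cvgM; [exact: cvg_id|apply: cvgB; [exact: cvg_cst|exact: cvg_id]].
have q0 t : 0 <= q t by rewrite /q le_max lexx.
have qout t : ~ (0 < t < 1) -> q t = 0.
  by move=> ht; apply/max_idPl; apply/negP => /negP; rewrite -ltNge => h; apply: ht; nra.
have [F dF] := continuous_primitive cq.
have mvt x y : x <= y -> exists z, [/\ x <= z <= y & F y - F x = q z * (y - x)].
  move=> xy; have [c] := @MVT_segment _ F q x y xy
      (fun t _ => dF t) (@is_derive_within R q F x y (fun t _ => dF t)).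
  by rewrite in_itv /= => cI e; exists c.
have mono x y : x <= y -> F x <= F y.
  by move=> xy; have [z [_ e]] := mvt _ _ xy; rewrite -subr_ge0 e mulr_ge0 // subr_ge0.
have F0 t : t <= 0 -> F t = F 0.
  move=> /[dup] t0 /mvt [z [zI e]]; apply/esym/eqP; rewrite -subr_eq0 e qout ?mul0r //; lra.
have F1 t : 1 <= t -> F t = F 1.
  move=> /[dup] t0 /mvt [z [zI e]]; apply/eqP; rewrite -subr_eq0 e qout ?mul0r //; lra.
have F01 : 0 < F 1 - F 0.
  have [z [zI e]] := mvt 4^-1 (3 / 4) ltac:(lra).
  have : 0 < q z by rewrite /q lt_max; apply/orP; right; nra.
  have := mono 0 4^-1 ltac:(lra); have := mono (3 / 4) 1 ltac:(lra); nra.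
pose c := (F 1 - F 0)^-1.
have c0 : 0 < c by rewrite invr_gt0.
exists (fun t => c * (F t - F 0)), (fun t => c * q t); split.
- by move=> t; have := dF t => h; apply: is_derive_eq; rewrite /GRing.scale /= subr0.
- by move=> t; apply: cvgMl_tmp; exact: cq.
- move=> t; split => [/F0 ->|/F1 ->]; first by rewrite subrr mulr0.
  by rewrite mulVf // gt_eqF.
- move=> t; rewrite mulr_ge0 ?(ltW c0) ?subr_ge0 //=; last first.
    by have [/F0 ->|/ltW/mono] := leP t 0.
  rewrite -[leRHS](mulVf (lt0r_neq0 F01)) ler_pM2l // lerD2r.
  by have [/ltW/mono|/F1 ->] := ltP t 1.
- move=> t; split; first by rewrite mulr_ge0 ?(ltW c0).
  by move=> /qout ->; rewrite mulr0.
Qed.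

Lemma test_functionP p q a b : (forall x, is_derive x 1 p (q x)) -> continuous q ->
  0 < a -> b < 1 -> (forall x, ~ (a <= x <= b) -> p x = 0) -> test_function p.
Proof.
move=> dp cq a0 b1 p0; split.
- by move=> x; case: (dp x).
- by rewrite (_ : p^`()%classic = q) //; apply/funext => x; exact: is_derive_val.
- exists a, b; split => // x xI; apply: p0; move: xI; rewrite notin_setE /= in_itv /=; exact.
Qed.

Lemma test_weak_derivative w g p q a b : weak_derivative w g ->
  (forall x, is_derive x 1 p (q x)) -> continuous q ->
  0 < a -> b < 1 -> (forall x, ~ (a <= x <= b) -> p x = 0) ->
  int01 (fun s => w s * q s) = - int01 (fun s => g s * p s).
Proof.
move=> [_ wg] dp cq a0 b1 p0; have := wg _ (test_functionP dp cq a0 b1 p0).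
by rewrite (_ : p^`()%classic = q) //; apply/funext => x; exact: is_derive_val.
Qed.

Lemma C1_weak_derivative F q : (forall x, is_derive x 1 F (q x)) -> continuous q ->
  weak_derivative F q.
Proof.
move=> dF cq; split; first exact: continuous_sqi.
move=> p [dp cdp [a [b [a0 b1 p0]]]].
have cF : continuous F by move=> x; exact: is_derive_continuous (dF x).
have dp' x : is_derive x 1 p (p^`()%classic x) by split; [exact: dp|rewrite derive1E].
have cp : continuous p by move=> x; exact: is_derive_continuous (dp' x).
have dFp x : is_derive x 1 (fun s => F s * p s) (F x * p^`()%classic x + q x * p x).
  have := dF x; have := dp' x => h1 h2.
  by apply: is_derive_eq; rewrite /GRing.scale /=; ring.
have c1 : continuous (fun s => F s * p^`()%classic s).
  by move=> x; apply: cvgM; [exact: cF|exact: cdp].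
have c2 : continuous (fun s => q s * p s).
  by move=> x; apply: cvgM; [exact: cq|exact: cp].
have c12 : continuous (fun s => F s * p^`()%classic s + q s * p s).
  by move=> x; apply: cvgD; [exact: c1|exact: c2].
have := FTC01 dFp c12.
rewrite (int01D (continuous_itg01 c1) (continuous_itg01 c2)).
have out x : ~ (a <= x <= b) -> p x = 0.
  by move=> xI; apply: p0; rewrite notin_setE /= in_itv.
rewrite !out; [|lra|lra].
by rewrite !mulr0 subrr => /eqP; rewrite addr_eq0 => /eqP.
Qed.

End WeakDerivative.

Section TestWindows.
Context {R : realType}.
Implicit Types (f g h u v w F q p : R -> R) (a b x y s t z : R).

Lemma eventually_ge1 (e : R) : 0 < e -> exists N, forall n, (N <= n)%N -> 1 <= n%:R * e.
Proof.
move=> e0; have [N hN] : exists N, e^-1 <= N%:R.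
  by exists (Num.bound e^-1); apply/ltW/archi_boundP/ltW; rewrite invr_gt0.
by exists N => n Nn; rewrite -ler_pdivrMr // mul1r (le_trans hN) // ler_nat.
Qed.

(** The difference of two rescaled steps.  It serves twice: its derivative k1 - k2
    concentrates at x and y, and p itself approximates the indicator of ]x, y]. *)
Lemma smooth_window e x y : 0 < x -> x < y -> y + e < 1 -> 0 < e ->
  exists k1 k2 p : R -> R, [/\ continuous k1, continuous k2,
    [/\ int01 k1 = 1, int01 k2 = 1,
        forall s, 0 <= k1 s /\ (~ (x <= s <= x + e) -> k1 s = 0) &
        forall s, 0 <= k2 s /\ (~ (y <= s <= y + e) -> k2 s = 0)],
    forall s, is_derive s 1 p (k1 s - k2 s) &
    [/\ forall s, `|p s| <= 1, forall s, s <= x \/ y + e <= s -> p s = 0 &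
        forall s, x + e <= s <= y -> p s = 1]].
Proof.
move=> x0 xy ye e0.
have [S [s' [dS cs' S01 Sb s'0]]] := @smooth_step R.
pose step z s := S (e^-1 * s + - (e^-1 * z)).
pose k z s := e^-1 * s' (e^-1 * s + - (e^-1 * z)).
have ei0 : 0 < e^-1 by rewrite invr_gt0.
have arg z s : e^-1 * s + - (e^-1 * z) = (s - z) / e by field; lra.
have dstep z s : is_derive s 1 (step z) (k z s) by apply: is_derive_affine; exact: dS.
have ck z : continuous (k z).
  by move=> s; apply: cvgMl_tmp; exact: continuous_affine.
have cstep z : continuous (step z) by move=> s; exact: is_derive_continuous (dstep z s).
have step0 z s : s <= z -> step z s = 0.
  by move=> sz; rewrite /step arg; apply: (S01 _).1; rewrite ler_pdivrMr //; lra.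
have step1 z s : z + e <= s -> step z s = 1.
  by move=> sz; rewrite /step arg; apply: (S01 _).2; rewrite ler_pdivlMr //; lra.
have kP z s : 0 <= k z s /\ (~ (z <= s <= z + e) -> k z s = 0).
  split; first by apply: mulr_ge0; [exact: ltW|exact: (s'0 _).1].
  move=> h; rewrite /k arg (s'0 _).2 ?mulr0 // => /andP[h1 h2]; apply: h.
  by move: h1 h2; rewrite ltr_pdivrMr // ltr_pdivlMr //; lra.
have kI z : 0 < z -> z + e < 1 -> int01 (k z) = 1.
  by move=> z0 z1; rewrite (FTC01 (dstep z) (ck z)) (step1 z 1) ?(step0 z 0) ?subr0 //; lra.
exists (k x), (k y), (fun s => step x s - step y s); split; try exact: ck.
- by split; try exact: kP; apply: kI; lra.
- by move=> s; have := dstep x s; have := dstep y s => h1 h2; exact: is_deriveB.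
- split.
  + move=> s; rewrite ler_norml; have := Sb (e^-1 * s + - (e^-1 * x)).
    by have := Sb (e^-1 * s + - (e^-1 * y)); rewrite /step; lra.
  + by move=> s [sx|sy]; [rewrite !step0|rewrite !step1]; rewrite ?subrr //; lra.
  + by move=> s sI; rewrite step1 ?step0 ?subr0 //; lra.
Qed.

Lemma continuous_dist_near w z e1 : continuous w -> 0 < e1 ->
  exists2 d, 0 < d & forall s, `|s - z| <= d -> `|w s - w z| < e1.
Proof.
move=> cw e0; have /cvgrPdist_lt /(_ _ e0) /nbhs_ballP [d /= d0 hd] := cw z.
exists (d / 2); first lra.
by move=> s sz; rewrite distrC; apply: hd; rewrite /ball /= distrC; lra.
Qed.

(** Testing with a window makes int w (k1 - k2) close to w x - w y, while the
    integral against g is at most int |g| because the window is bounded by 1. *)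
Lemma weak_derivative_oscillation w g : {within `[0, 1], continuous w} -> weak_derivative w g ->
  forall x y, 0 < x < 1 -> 0 < y < 1 -> `|w x - w y| <= int01 (fun s => `|g s|).
Proof.
move=> /within_extend [W cW Ww] wg x y xI yI.
have gi : itg01 g by apply: sqi_itg; case: wg.
wlog xy : x y xI yI / x < y => [hw|].
  have [xy|yx|->] := ltgtP x y; first exact: hw.
    by rewrite distrC; exact: hw.
  rewrite subrr normr0; apply: int01_ge0 => s _; exact: normr_ge0.
set m := int01 _.
apply/ler_addgt0Pr => eps eps0.
have e2 : 0 < eps / 2 by lra.
have [d1 d10 h1] := continuous_dist_near x cW e2.
have [d2 d20 h2] := continuous_dist_near y cW e2.
(* narrow enough for both oscillation bounds and for the window to end before 1 *)
pose e := Num.min (Num.min d1 d2) ((1 - y) / 2).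
have [e0 ed1 ed2 ey] : [/\ 0 < e, e <= d1, e <= d2 & y + e < 1].
  split; rewrite /e ?lt_min ?ge_min ?lexx ?orbT ?d10 ?d20 //=; first lra.
  by rewrite -ltrBrDl gt_min; apply/orP; right; lra.
have [k1 [k2 [p [ck1 ck2 [i1 i2 k1P k2P] dp [pb p0 _]]]]] :=
  smooth_window (ltac:(lra) : 0 < x) xy ey e0.
have cp : continuous p by move=> s; exact: is_derive_continuous (dp s).
have : int01 (fun s => w s * (k1 s - k2 s)) = - int01 (fun s => g s * p s).
  apply: (test_weak_derivative wg dp (a := x) (b := y + e)) => //; try lra.
    by move=> s; apply: cvgB; [exact: ck1|exact: ck2].
  by move=> s /negP; rewrite negb_and -!ltNge => /orP sI; apply: p0; lra.
have -> : int01 (fun s => w s * (k1 s - k2 s)) =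
          int01 (fun s => W s * k1 s) - int01 (fun s => W s * k2 s).
  have cM k : continuous k -> continuous (fun s => W s * k s).
    by move=> ck s; apply: cvgM; [exact: cW|exact: ck].
  rewrite -int01B; try by apply/continuous_itg01/cM.
  by apply: int01_eq => s sI; rewrite Ww; [ring|lra].
(* an average of W over [z, z + e] differs from W z by at most eps / 2 *)
have avg z k d : continuous k -> int01 k = 1 -> e <= d ->
    (forall s, 0 <= k s /\ (~ (z <= s <= z + e) -> k s = 0)) ->
    (forall s, `|s - z| <= d -> `|W s - W z| < eps / 2) ->
    W z - eps / 2 <= int01 (fun s => W s * k s) <= W z + eps / 2.
  move=> ck ki ed kP hd.
  have cM : continuous (fun s => W s * k s).
    by move=> s; apply: cvgM; [exact: cW|exact: ck].
  have main s : (W z - eps / 2) * k s <= W s * k s <= (W z + eps / 2) * k s.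
    have [k0 kout] := kP s.
    have [sI|/negP/kout ->] := boolP (z <= s <= z + e); last by rewrite !mulr0 lexx.
    have : `|W s - W z| < eps / 2 by apply: hd; rewrite ger0_norm; lra.
    by rewrite ltr_norml => /andP[h3 h4]; rewrite !ler_wpM2r //; lra.
  have ik := continuous_itg01 ck; have iM := continuous_itg01 cM.
  have cst_avg c : c = int01 (fun s => c * k s) by rewrite (int01Z _ ik) ki mulr1.
  rewrite [W z - eps / 2]cst_avg [W z + eps / 2]cst_avg.
  apply/andP; split; apply: int01_le => //; try exact: itg01Z.
    by move=> s _; case/andP: (main s).
  by move=> s _; case/andP: (main s).
have := avg x k1 d1 ck1 i1 ed1 k1P h1; have := avg y k2 d2 ck2 i2 ed2 k2P h2.
move=> a2 a1 eq.
have gpi : itg01 (fun s => g s * p s).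
  apply: (itg01_eq (f := fun s => p s * g s)); first by move=> s _; rewrite mulrC.
  by apply: (itg01_mul_bounded (C := 1)) => //; exact: measurable_continuous.
have : `|- int01 (fun s => g s * p s)| <= m.
  rewrite normrN (le_trans (int01_norm gpi)) //; apply: int01_le.
  - exact: itg01_norm.
  - exact: itg01_norm.
  - by move=> s _; rewrite normrM -[leRHS]mulr1 ler_wpM2l.
rewrite -eq -!Ww; [|lra|lra].
by rewrite !ler_norml; lra.
Qed.

End TestWindows.

Section WeakDerivativeTheory.
Context {R : realType}.
Implicit Types (f g h u v w F q p : R -> R) (a b x y s t z : R).
Notation mu := (@lebesgue_measure R).
Local Notation I01 := (`](0 : R), 1[%classic).

(** Test functions must vanish near 0 and 1, but p only vanishes at these points.
    The cut-offs S (n s - 1) and S (n (1 - s) - 1) have slope of order n on a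
    layer of width 2/n where p = O(1/n), so the derivative of the truncated p
    stays bounded and dominated convergence applies. *)
Lemma weak_derivative_by_parts w g p q : {within `[0, 1], continuous w} ->
  weak_derivative w g ->
  (forall x, is_derive x 1 p (q x)) -> continuous q -> p 0 = 0 -> p 1 = 0 ->
  int01 (fun s => w s * q s) = - int01 (fun s => g s * p s).
Proof.
move=> /within_extend [W cW Ww] wg dp cq p0 p1.
have gi : itg01 g by apply: sqi_itg; case: wg.
have cp : continuous p by move=> x; exact: is_derive_continuous (dp x).
have [S [s' [dS cs' S01 Sb s'0]]] := @smooth_step R.
pose al n s := S (n.+1%:R * s + -1).
(* the argument is (n + 1) (1 - s) - 1 *)
pose be n s := S (- n.+1%:R * s + (n%:R)).
pose al' n s := n.+1%:R * s' (n.+1%:R * s + -1).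
pose be' n s := - n.+1%:R * s' (- n.+1%:R * s + (n%:R)).
have dal n s : is_derive s 1 (al n) (al' n s) by apply: is_derive_affine; exact: dS.
have dbe n s : is_derive s 1 (be n) (be' n s) by apply: is_derive_affine; exact: dS.
have cal n : continuous (al n) by move=> s; exact: is_derive_continuous (dal n s).
have cbe n : continuous (be n) by move=> s; exact: is_derive_continuous (dbe n s).
have cal' n : continuous (al' n) by move=> s; apply: cvgMl_tmp; exact: continuous_affine.
have cbe' n : continuous (be' n) by move=> s; apply: cvgMl_tmp; exact: continuous_affine.
pose p_ n s := p s * (al n s * be n s).
pose q_ n s := q s * (al n s * be n s) + p s * (al' n s * be n s + al n s * be' n s).
have dp_ n s : is_derive s 1 (p_ n) (q_ n s).
  have := dp s; have := dal n s; have := dbe n s => h1 h2 h3.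
  by apply: is_derive_eq; rewrite /q_ /GRing.scale /=; ring.
have cp_ n : continuous (p_ n) by move=> s; exact: is_derive_continuous (dp_ n s).
have cq_ n : continuous (q_ n).
  move=> s; apply: cvgD; apply: cvgM; try exact: cq; try exact: cp.
    by apply: cvgM; [exact: cal|exact: cbe].
  by apply: cvgD; apply: cvgM; [exact: cal'|exact: cbe|exact: cal|exact: cbe'].
have n0 n : 0 < n.+1%:R :> R by rewrite ltr0n.
have nS n : n.+1%:R = n%:R + 1 :> R by rewrite -natr1.
have eqn n : int01 (fun s => W s * q_ n s) = - int01 (fun s => g s * p_ n s).
  rewrite -(test_weak_derivative wg (dp_ n) (cq_ n) (a := n.+1%:R^-1) (b := 1 - n.+1%:R^-1)).
  - by apply: int01_eq => s sI; rewrite Ww //; lra.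
  - by rewrite invr_gt0.
  - by rewrite ltrBlDr ltrDl invr_gt0.
  - move=> s sI; rewrite /p_.
    have [h|h] := ltP s n.+1%:R^-1.
      rewrite /al (S01 _).1 ?mul0r ?mulr0 //.
      by move: h; rewrite -[n.+1%:R^-1]mul1r ltr_pdivlMr // mulrC; lra.
    have h2 : 1 - n.+1%:R^-1 < s.
      by rewrite ltNge; apply/negP => h2; apply: sI; rewrite h h2.
    rewrite /be (S01 _).1 ?mulr0 //.
    have : (1 - s) * n.+1%:R < 1.
      by rewrite -ltr_pdivlMr // mul1r ltrBlDr -ltrBlDl.
    by rewrite mulNr mulrBl nS; nra.
have [C C0 hC] := continuous_bounded01 cq.
have [M M0 hM] := continuous_bounded01 cs'.
have [K K0 hK] := continuous_bounded01 cW.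
have s'M t : 0 <= s' t <= M.
  have [s'p s'out] := s'0 t; rewrite s'p /=.
  have [tI|/negP/s'out -> //] := boolP (0 < t < 1).
  by rewrite -[leLHS](ger0_norm s'p); apply: hM; lra.
have slope x y : 0 <= x -> x <= y -> y <= 1 -> `|p y - p x| <= C * (y - x).
  move=> x0 xy y1; have [c] := @MVT_segment _ p q x y xy
      (fun t _ => dp t) (@is_derive_within R q p x y (fun t _ => dp t)).
  rewrite in_itv /= => cI ->; rewrite normrM (ger0_norm (_ : 0 <= y - x)) ?subr_ge0 //.
  by rewrite ler_wpM2r ?subr_ge0 // hC //; lra.
have pl s : 0 <= s <= 1 -> `|p s| <= C * s.
  by move=> /andP[s0 s1]; have := slope _ _ (lexx 0) s0 s1; rewrite p0 !subr0.
have pr s : 0 <= s <= 1 -> `|p s| <= C * (1 - s).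
  by move=> /andP[s0 s1]; have := slope _ _ s0 s1 (lexx 1); rewrite p1 sub0r normrN.
have nprod (a b C1 C2 : R) : `|a| <= C1 -> `|b| <= C2 -> `|a * b| <= C1 * C2.
  by move=> h1 h2; rewrite normrM ler_pM.
have alb n s : `|al n s| <= 1 by rewrite ger0_norm; case/andP: (Sb (n.+1%:R * s + -1)).
have beb n s : `|be n s| <= 1 by rewrite ger0_norm; case/andP: (Sb (- n.+1%:R * s + n%:R)).
have pal n s : 0 < s < 1 -> `|p s * al' n s| <= 2 * C * M.
  move=> sI; rewrite normrM /al' normrM (ger0_norm (ltW (n0 n))).
  have [k0 kM] := andP (s'M (n.+1%:R * s + -1)).
  have [h|/negP/(s'0 _).2 ->] := boolP (0 < n.+1%:R * s + -1 < 1); last first.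
    by rewrite normr0 !mulr0 !mulr_ge0.
  rewrite (ger0_norm k0) mulrA ler_pM //.
  have ps : `|p s| <= C * s by apply: pl; lra.
  rewrite (le_trans (y := C * s * n.+1%:R)) ?ler_wpM2r //.
  rewrite -mulrA [2 * C]mulrC ler_wpM2l // mulrC; lra.
have pbe n s : 0 < s < 1 -> `|p s * be' n s| <= 2 * C * M.
  move=> sI; rewrite normrM /be' normrM normrN (ger0_norm (ltW (n0 n))).
  have [k0 kM] := andP (s'M (- n.+1%:R * s + n%:R)).
  have [h|/negP/(s'0 _).2 ->] := boolP (0 < - n.+1%:R * s + n%:R < 1); last first.
    by rewrite normr0 !mulr0 !mulr_ge0.
  rewrite (ger0_norm k0) mulrA ler_pM //.
  have ps : `|p s| <= C * (1 - s) by apply: pr; lra.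
  rewrite (le_trans (y := C * (1 - s) * n.+1%:R)) ?ler_wpM2r //.
  rewrite -mulrA [2 * C]mulrC ler_wpM2l // mulrBl nS; move: h; rewrite nS; lra.
have lim_q : int01 (fun s => W s * q_ n s) @[n --> \oo] --> int01 (fun s => W s * q s).
  apply: (@int01_dct R _ _ (fun=> K * (C + (2 * C * M + 2 * C * M)))).
  - by move=> n; apply: measurable_continuous => s; apply: cvgM; [exact: cW|exact: cq_].
  - move=> s /andP[s0 s1]; apply: cvg_near_cst.
    have [N1 h1] := @eventually_ge1 R (s / 2) ltac:(lra).
    have [N2 h2] := @eventually_ge1 R ((1 - s) / 2) ltac:(lra).
    exists (maxn N1 N2) => // n /=; rewrite geq_max => /andP[n1 n2].
    have a1 : 1 <= n.+1%:R * s + -1 by have := h1 n.+1 (leqW n1); lra.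
    have b1 : 1 <= - n.+1%:R * s + n%:R.
      by have := h2 n.+1 (leqW n2); rewrite nS; lra.
    rewrite /q_ /al /be /al' /be' !(S01 _).2 // !(s'0 _).2; [|lra|lra].
    by rewrite !(mulr0, mul0r, mulr1, addr0).
  - exact: itg01_cst.
  - move=> n s sI; apply: (nprod); first by apply: hK; lra.
    rewrite /q_ (le_trans (ler_normD _ _)) // lerD //.
      by rewrite -[leRHS]mulr1 nprod ?hC //; [lra|rewrite -[leRHS]mulr1 nprod].
    rewrite mulrDr (le_trans (ler_normD _ _)) // lerD //.
      by rewrite mulrA -[leRHS]mulr1 nprod // pal.
    by rewrite mulrCA -[leRHS]mul1r nprod // pbe.
have lim_p : - int01 (fun s => g s * p_ n s) @[n --> \oo] --> - int01 (fun s => g s * p s).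
  apply: cvgN; apply: (@int01_dct R _ _ (fun s => C * `|g s|)).
  - move=> n; apply: measurable_funM; first exact: itg01_measurable.
    exact: measurable_continuous.
  - move=> s /andP[s0 s1]; apply: cvg_near_cst.
    have [N1 h1] := @eventually_ge1 R (s / 2) ltac:(lra).
    have [N2 h2] := @eventually_ge1 R ((1 - s) / 2) ltac:(lra).
    exists (maxn N1 N2) => // n /=; rewrite geq_max => /andP[n1 n2].
    have a1 : 1 <= n.+1%:R * s + -1 by have := h1 n.+1 (leqW n1); lra.
    have b1 : 1 <= - n.+1%:R * s + n%:R.
      by have := h2 n.+1 (leqW n2); rewrite nS; lra.
    by rewrite /p_ /al /be !(S01 _).2 // !mulr1.
  - exact/itg01Z/itg01_norm.
  - move=> n s sI; rewrite mulrC; apply: (nprod) => //.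
    rewrite -[leRHS]mulr1; apply: (nprod); last by rewrite -[leRHS]mulr1 nprod.
    have ps : `|p s| <= C * s by apply: pl; lra.
    by rewrite (le_trans ps) // -[leRHS]mulr1 ler_wpM2l //; lra.
rewrite -(@int01_eq R (fun s => W s * q s)); last by move=> s sI; rewrite Ww //; lra.
move: lim_q; rewrite (_ : (fun n => int01 (fun s => W s * q_ n s)) =
  (fun n => - int01 (fun s => g s * p_ n s))); last by apply/funext => n; exact: eqn.
by move=> lim_q; apply: cvg_unique lim_q lim_p; exact: Rhausdorff.
Qed.

(** Windows of vanishing ramp converge to the indicator of ]x, y] and stay below 1. *)
Lemma test_orthogonal_window h x y : itg01 h -> 0 < x -> x < y -> y < 1 ->
  (forall p, test_function p -> int01 (fun s => h s * p s) = 0) ->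
  int01 (fun s => h s * (if x < s <= y then 1 else 0)) = 0.
Proof.
move=> hi x0 xy y1 h0.
(* the offset 2 keeps y + e n strictly below 1 for every n *)
pose e n : R := (1 - y) / n.+2%:R.
have e0 n : 0 < e n by rewrite divr_gt0 ?ltr0n // subr_gt0.
have ye n : y + e n < 1.
  by rewrite -ltrBrDl /e ltr_pdivrMr ?ltr0n // ltr_pMr ?subr_gt0 // ltr1n.
have /choice [p hp] : forall n, exists p : R -> R, [/\ test_function p,
    forall s, `|p s| <= 1, forall s, s <= x \/ y + e n <= s -> p s = 0 &
    forall s, x + e n <= s <= y -> p s = 1].
  move=> n; have [k1 [k2 [p [ck1 ck2 _ dp [pb p0 p1]]]]] := smooth_window x0 xy (ye n) (e0 n).
  exists p; split => //; apply: (test_functionP dp (a := x) (b := y + e n)) => //.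
    by move=> s; apply: cvgB; [exact: ck1|exact: ck2].
  by move=> s /negP; rewrite negb_and -!ltNge => /orP sI; apply: p0; lra.
have en d : 0 < d -> exists N, forall n, (N <= n)%N -> e n <= d.
  move=> d0; have [N hN] := eventually_ge1 (divr_gt0 d0 (ltac:(lra) : 0 < 1 - y)).
  exists N => n Nn; rewrite /e ler_pdivrMr ?ltr0n //.
  have := hN n.+2 (leqW (leqW Nn)).
  by rewrite mulrA ler_pdivlMr ?subr_gt0 // mul1r mulrC.
apply: (@cvg_unique R (@Rhausdorff R) (int01 (fun s => h s * p n s) @[n --> \oo])).
  apply: (@int01_dct R _ _ (fun s => `|h s|)).
  - move=> n; apply: measurable_funM; first exact: itg01_measurable.
    apply: measurable_continuous => s; have [[dp _ _] _ _ _] := hp n.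
    exact/differentiable_continuous/derivable1_diffP.
  - move=> s sI; apply: cvg_near_cst; have [sx|xs] := leP s x.
      by apply: nearW => n; have [_ _ -> //] := hp n; left.
    have [sy|ys] := leP s y.
      have [N hN] := en (s - x) ltac:(lra); exists N => // n /= /hN hb.
      by have [_ _ _ -> //] := hp n; lra.
    have [N hN] := en (s - y) ltac:(lra); exists N => // n /= /hN hb.
    by have [_ _ -> //] := hp n; right; lra.
  - exact: itg01_norm.
  - by move=> n s _; have [_ pb _ _] := hp n; rewrite normrM -[leRHS]mulr1 ler_wpM2l.
rewrite (_ : (fun n => _) = (fun=> 0)); first exact: cvg_cst.
by apply/funext => n; apply: h0; have [] := hp n.
Qed.

(** The integrals of h over all intervals vanish, so its indefinite integral is
    constant; by Lebesgue differentiation its derivative is h almost everywhere. *)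
Lemma test_orthogonal_ae0 h : itg01 h ->
  (forall p, test_function p -> int01 (fun s => h s * p s) = 0) ->
  ae_eq mu I01 h (fun=> 0).
Proof.
move=> hi h0.
pose h1 : R -> R := h \_ I01.
have h1i : mu.-integrable setT (EFin \o h1).
  by rewrite /h1 -restrict_EFin; apply/integrable_restrict => //; rewrite setTI.
pose F x := \int[mu]_(t in `]-oo, x]) h1 t.
have h1iy y : mu.-integrable `]-oo, y] (EFin \o h1) by apply: integrableS h1i.
have Fcst x y : 0 < x -> x < y -> y < 1 -> F y = F x.
  move=> x0 xy y1; apply/eqP; rewrite -subr_eq0 /F.
  rewrite (@Rintegral_itvB R h1 (BInfty _ true) (BRight y) x (h1iy y)) //; last first.
    by rewrite bnd_simp ltW.
  rewrite -(test_orthogonal_window hi x0 xy y1 h0) /int01; apply/eqP.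
  rewrite Rintegral_mkcond [RHS]Rintegral_mkcond; apply: eq_Rintegral => t _.
  rewrite /h1 !patchE !mem_setE /= !in_itv /=.
  case: ifPn => [tI|tn]; case: ifPn => [tI2|tn2]; rewrite ?mulr1 ?mulr0 //.
have := @FTC1Ny R h1 h1iy (integrable_locally (@measurable_itv _ _) hi).
apply: filterS; first exact: (ae_filter_ringOfSetsType mu).
move=> x /= [dF eF]; rewrite in_itv /= => xI.
have : is_derive x 1 F 0.
  apply: near_eq_is_derive (is_derive_cst (F x) x 1).
  near=> t; have tI : 0 < t < 1.
    by apply/andP; split; near: t; [apply: lt_nbhsr|apply: lt_nbhsl]; lra.
  rewrite /cst; have [tx|xt|-> //] := ltgtP t x.
    by apply: Fcst; lra.
  by apply/esym/Fcst; lra.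
move=> /is_derive_val; rewrite eF /h1 patchE mem_set //= in_itv //=.
Unshelve. all: by end_near. Qed.

(** This makes the chosen representative [wderiv u] interchangeable with any
    weak derivative that is known explicitly. *)
Lemma weak_derivative_unique u g1 g2 : weak_derivative u g1 -> weak_derivative u g2 ->
  ae_eq mu I01 g1 g2.
Proof.
move=> [s1 wg1] [s2 wg2]; have i1 := sqi_itg s1; have i2 := sqi_itg s2.
have ipM g p : itg01 g -> test_function p -> itg01 (fun s => g s * p s).
  move=> gi [dp _ _].
  have cp : continuous p by move=> s; exact/differentiable_continuous/derivable1_diffP.
  have [C _ pC] := continuous_bounded01 cp.
  apply: (itg01_eq (f := fun s => p s * g s)); first by move=> s _; rewrite mulrC.
  apply: (itg01_mul_bounded (C := C)) => //; first exact: measurable_continuous.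
  by move=> s sI; apply: pC; lra.
have := @test_orthogonal_ae0 (fun s => g1 s - g2 s) (itg01B i1 i2).
have h0 p : test_function p -> int01 (fun s => (g1 s - g2 s) * p s) = 0.
  move=> tp; rewrite (@int01_eq R _ (fun s => g1 s * p s - g2 s * p s)); last first.
    by move=> s _; rewrite mulrBl.
  rewrite int01B; try exact: ipM.
  have /oppr_inj e12 := etrans (esym (wg1 _ tp)) (wg2 _ tp).
  by rewrite /int01 e12 subrr.
move=> /(_ h0); apply: filterS => s h /h /eqP; rewrite subr_eq0 => /eqP //.
Qed.

End WeakDerivativeTheory.

(** * Sharp Poincare inequality for mean-zero functions *)

Section Poincare.
Context {R : realType}.
Implicit Types (f g h u v w F q p Y : R -> R) (a b x y s t z : R).
Notation mu := (@lebesgue_measure R).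
Local Notation I01 := (`](0 : R), 1[%classic).

Lemma wderivP u : (exists g, weak_derivative u g) -> weak_derivative u (wderiv u).
Proof. by case=> g ug; apply: (@getI _ [set g | weak_derivative u g] g). Qed.

Lemma wderiv_ae u g : weak_derivative u g -> ae_eq mu I01 (wderiv u) g.
Proof.
by move=> ug; exact: weak_derivative_unique (wderivP (ex_intro _ g ug)) ug.
Qed.

Lemma within_sub u v (A : set R) : {within A, continuous u} -> {within A, continuous v} ->
  {within A, continuous (v \- u)}.
Proof. by move=> cu cv x; apply: (@continuousB); [exact: cv|exact: cu]. Qed.

Lemma weak_derivative_sub u v g1 g2 :
  {within `[0, 1], continuous u} -> {within `[0, 1], continuous v} ->
  weak_derivative u g1 -> weak_derivative v g2 ->
  weak_derivative (v \- u) (fun s => g2 s - g1 s).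
Proof.
move=> cu cv [s1 w1] [s2 w2]; split; first exact: sqiB.
move=> p tp; have [dp cdp _] := tp.
have cp : continuous p by move=> s; exact/differentiable_continuous/derivable1_diffP.
have i1 : itg01 (fun s => u s * p^`()%classic s).
  by apply: sqi_mul; [exact: within_sqi|exact: continuous_sqi].
have i2 : itg01 (fun s => v s * p^`()%classic s).
  by apply: sqi_mul; [exact: within_sqi|exact: continuous_sqi].
have j1 : itg01 (fun s => g1 s * p s) by apply: sqi_mul => //; exact: continuous_sqi.
have j2 : itg01 (fun s => g2 s * p s) by apply: sqi_mul => //; exact: continuous_sqi.
rewrite -/(int01 _) -[X in _ = - X]/(int01 _).
rewrite (@int01_eq R _ (fun s => v s * p^`()%classic s - u s * p^`()%classic s)); last first.
  by move=> s _; rewrite /= mulrBl.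
rewrite (@int01_eq R (fun s => (g2 s - g1 s) * p s) (fun s => g2 s * p s - g1 s * p s)); last first.
  by move=> s _; rewrite mulrBl.
rewrite (int01B i2 i1) (int01B j2 j1).
by rewrite [int01 (fun s => v s * _)]w2 // [int01 (fun s => u s * _)]w1 // opprD.
Qed.

(** With T s = - k tan (k (s - 1/2)) one has T' = - (k^2 + T^2), hence
    w^2 - k^2 Y^2 = (w - T Y)^2 + (T Y^2)'.  For k < pi the function T is smooth
    on [0, 1], and the boundary terms vanish with Y; the optimal constant pi is
    reached by letting k tend to pi, so no singular weight is needed. *)
Lemma dirichlet_wirtinger_lt (k : R) w Y : 0 < k -> k < pi -> continuous w ->
  (forall x, is_derive x 1 Y (w x)) -> Y 0 = 0 -> Y 1 = 0 ->
  k ^+ 2 * int01 (fun s => Y s ^+ 2) <= int01 (fun s => w s ^+ 2).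
Proof.
move=> k0 kpi cw dY Y0 Y1.
have cY : continuous Y by move=> x; exact: is_derive_continuous (dY x).
have cd : continuous (fun s => w s ^+ 2 - k ^+ 2 * Y s ^+ 2).
  by move=> s; apply: cvgB; [exact: continuous_sqr|apply: cvgMl_tmp; exact: continuous_sqr].
have [A dA] := continuous_primitive cd.
pose T s := - k * tan (k * s + - (k / 2)).
have dT s : 0 <= s <= 1 -> is_derive s 1 T (- (k ^+ 2 + T s ^+ 2)).
  move=> sI.
  have cs : cos (k * s + - (k / 2)) != 0.
    by apply/lt0r_neq0/cos_gt0_pihalf; apply/andP; split; nra.
  have dt := is_derive_affine (is_derive_tan cs).
  apply: is_derive_eq; rewrite /GRing.scale /= /T.
  have := cos2Dsin2 (k * s - k / 2).
  rewrite /tan; set c := cos _ in cs *; set d := sin _ => e.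
  have -> : (c ^+ 2)^-1 = 1 + (d / c) ^+ 2.
    by rewrite -[LHS]mul1r -{1}e; field.
  ring.
pose N s := A s - T s * Y s ^+ 2.
have dN s : 0 <= s <= 1 -> is_derive s 1 N ((w s - T s * Y s) ^+ 2).
  move=> sI; have := dT s sI; have := dA s; have := dY s => h1 h2 h3.
  apply: is_derive_eq; rewrite /GRing.scale /=; ring.
have [c _ eN] := @MVT_segment _ N (fun s => (w s - T s * Y s) ^+ 2) 0 1 ler01
  (fun s (hs : s \in `]0, 1[%R) => dN s ltac:(move: hs; rewrite in_itv /=; lra))
  (@is_derive_within R (fun s => (w s - T s * Y s) ^+ 2) N 0 1 (fun t ht => dN t ht)).
have : 0 <= A 1 - A 0.
  have : 0 <= N 1 - N 0 by rewrite eN subr0 mulr1 sqr_ge0.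
  by rewrite /N Y0 Y1; lra.
rewrite -(FTC01 dA cd).
have i1 := continuous_itg01 (continuous_sqr cw).
have i2 := continuous_itg01 (continuous_sqr cY).
by rewrite (int01B i1 (itg01Z _ i2)) (int01Z _ i2) subr_ge0.
Qed.

Lemma dirichlet_wirtinger w Y : continuous w ->
  (forall x, is_derive x 1 Y (w x)) -> Y 0 = 0 -> Y 1 = 0 ->
  pi ^+ 2 * int01 (fun s => Y s ^+ 2) <= int01 (fun s => w s ^+ 2).
Proof.
move=> cw dY Y0 Y1.
have J0 : 0 <= int01 (fun s => Y s ^+ 2) by apply: int01_ge0 => s _; exact: sqr_ge0.
have pi0 := pi_gt0 R.
rewrite leNgt; apply/negP => lt.
set J := int01 (fun s => Y s ^+ 2) in J0 lt.
set K := int01 _ in lt.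
(* k = pi - e still has k^2 J > K, contradicting the previous lemma *)
pose e := Num.min (pi / 2) ((pi ^+ 2 * J - K) / (2 * pi * (J + 1))).
have den : 0 < 2 * pi * (J + 1) by rewrite !mulr_gt0 //; lra.
have e0 : 0 < e.
  by rewrite lt_min divr_gt0 //=; apply: divr_gt0 => //; lra.
have e1 : e <= pi / 2 by rewrite ge_min lexx.
have e2 : e * (2 * pi * (J + 1)) <= pi ^+ 2 * J - K.
  by rewrite -ler_pdivlMr // ge_min lexx orbT.
have := dirichlet_wirtinger_lt (k := pi - e) ltac:(lra) ltac:(lra) cw dY Y0 Y1.
rewrite -/J -/K; nra.
Qed.

(** The primitive Y of w vanishes at both ends because w has mean zero, so
    int g Y = - int w^2 and the Dirichlet inequality holds for Y.  Expanding
    0 <= int (g + pi^2 Y)^2 then gives the claim. *)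
Lemma neumann_poincare w g : {within `[0, 1], continuous w} -> weak_derivative w g ->
  int01 w = 0 -> pi ^+ 2 * int01 (fun s => w s ^+ 2) <= int01 (fun s => g s ^+ 2).
Proof.
move=> cw wg w0; have [W cW Ww] := within_extend cw.
have [Y0 dY0] := continuous_primitive cW.
pose Y s := Y0 s - Y0 0.
have dY s : is_derive s 1 Y (W s).
  by have := dY0 s => h; apply: is_derive_eq; rewrite subr0.
have Y00 : Y 0 = 0 by rewrite /Y subrr.
have Y10 : Y 1 = 0.
  rewrite /Y -(FTC01 dY0 cW) -w0; apply: int01_eq => s sI; apply: Ww; lra.
have cY : continuous Y by move=> x; exact: is_derive_continuous (dY x).
have := weak_derivative_by_parts cw wg dY cW Y00 Y10.
rewrite (@int01_eq R _ (fun s => w s ^+ 2)); last by move=> s sI; rewrite Ww //; lra.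
have := dirichlet_wirtinger cW dY Y00 Y10.
rewrite (@int01_eq R (fun s => W s ^+ 2) (fun s => w s ^+ 2)); last by move=> s sI; rewrite Ww //; lra.
have sg : square_integrable g by case: wg.
have [_ ig] := sg; have sY := continuous_sqi cY; have [_ iY] := sY.
have igY := sqi_mul sg sY.
have : 0 <= int01 (fun s => (g s ^+ 2 + 2 * pi ^+ 2 * (g s * Y s)) + pi ^+ 4 * Y s ^+ 2).
  apply: int01_ge0 => s _; have := sqr_ge0 (g s + pi ^+ 2 * Y s); congr (_ <= _); ring.
rewrite (int01D (itg01D ig (itg01Z _ igY)) (itg01Z _ iY)) (int01D ig (itg01Z _ igY)).
rewrite !int01Z //.
set J := int01 (fun s => Y s ^+ 2); set K := int01 (fun s => w s ^+ 2).
have := sqr_ge0 (pi : R); set P := pi ^+ 2 => P0.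
have -> : pi ^+ 4 = P * P :> R by rewrite /P; ring.
by nra.
Qed.

End Poincare.

(** * The dual stored energy and the sign of the stiffness *)

Section RealFunctions.
Context {R : realType}.
Implicit Types (f : R -> R) (x y z l lo hi h k : R).

Lemma zero_between f lo hi x y : (forall z, lo < z < hi -> {for z, continuous f}) ->
  lo < x < hi -> lo < y < hi -> f x <= 0 -> 0 <= f y ->
  exists2 c, lo < c < hi & f c = 0.
Proof.
move=> cf xI yI fx fy.
have cw a b : lo < a < hi -> lo < b < hi -> {within `[a, b], continuous f}.
  move=> aI bI; apply: continuous_in_subspaceT => z; rewrite inE /= in_itv /= => zI.
  by apply: cf; lra.
have [xy|/ltW yx] := leP x y.
  have [|c] := @IVT R f x y 0 xy (cw _ _ xI yI).
    by rewrite ge_min le_max fx fy orbT.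
  by rewrite in_itv /= => cI fc; exists c => //; lra.
have [|c] := @IVT R f y x 0 yx (cw _ _ yI xI).
  by rewrite ge_min le_max fx fy !orbT.
by rewrite in_itv /= => cI fc; exists c => //; lra.
Qed.


(** Only the derivative at x itself is used, so no monotonicity on a
    neighbourhood can be expected. *)
Lemma derive_gt0_increasing_at f x l : is_derive x 1 f l -> 0 < l ->
  exists2 d, 0 < d & forall y, (x < y < x + d -> f x < f y) /\ (x - d < y < x -> f y < f x).
Proof.
move=> [df eq] l0.
have cv : (fun h => h^-1 *: ((f \o shift x) (h *: 1) - f x)) @ 0^' --> l by rewrite -eq; exact: df.
have nr : \forall h \near (0 : R), h != 0 -> 0 < h^-1 *: ((f \o shift x) (h *: 1) - f x).
  exact: (cvgr_gt _ cv 0 l0).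
move/nbhs_ballP : nr => [d /= d0 hd].
exists d => // y; split => yI.
  have := hd (y - x); rewrite /ball /= sub0r normrN => /(_ _ _).
  rewrite ger0_norm; last lra.
  move=> /(_ ltac:(lra)) /(_ ltac:(by rewrite subr_eq0 gt_eqF; lra)).
  rewrite /shift /= /GRing.scale /= mulr1 subrK pmulr_rgt0 ?subr_gt0 // invr_gt0 subr_gt0; lra.
have := hd (y - x); rewrite /ball /= sub0r normrN => /(_ _ _).
rewrite ltr0_norm; last lra.
move=> /(_ ltac:(lra)) /(_ ltac:(by rewrite subr_eq0 lt_eqF; lra)).
by rewrite /shift /= /GRing.scale /= mulr1 subrK nmulr_rgt0 ?subr_lt0 // invr_lt0 subr_lt0; lra.
Qed.

(** Beyond h1 a nonpositive value would, by the intermediate value theorem, produce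
    a second zero.  Being positive on the right and vanishing at h1, G has
    nonnegative derivative there, hence positive; so G is negative just before
    h1, and then on all of ]0, h1[ by the same argument. *)
Lemma simple_zero_signs (G G1 : R -> R) (h1 K : R) : 0 < h1 ->
  (forall h, 0 < h -> is_derive h 1 G (G1 h)) ->
  G h1 = 0 -> G1 h1 != 0 -> (forall h, 0 < h -> G h = 0 -> h = h1) ->
  (forall h, 0 < h -> K < h -> 0 < G h) ->
  (forall h, h1 < h -> 0 < G h) /\ (forall h, 0 < h -> h < h1 -> G h < 0).
Proof.
move=> h10 dG Gh1 G1h1 Guniq GK.
have cG z : 0 < z -> {for z, continuous G}.
  by move=> /dG; exact: is_derive_continuous.
have pos h : h1 < h -> 0 < G h.
  move=> h1h; have h0 := lt_trans h10 h1h.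
  rewrite ltNge; apply/negP => Gh.
  pose k := Num.max h K + 1.
  have [kh kK] : h < k /\ K < k by rewrite /k !ltr_pwDr // le_max lexx ?orbT.
  have Gk : 0 < G k by apply: GK => //; exact: lt_trans kh.
  have cG' z : h1 < z < k + 1 -> {for z, continuous G} by move=> zI; apply: cG; lra.
  have [c cI Gc] := zero_between cG' (x := h) (y := k) ltac:(lra) ltac:(lra) Gh (ltW Gk).
  have := Guniq c ltac:(lra) Gc; lra.
split=> // h h0 hh1; rewrite ltNge; apply/negP => Gh.
have G1_gt0 : 0 < G1 h1.
  rewrite lt_neqAle eq_sym G1h1 /= leNgt; apply/negP => lt0.
  have dN : is_derive h1 1 (fun h => - G h) (- G1 h1) by apply: is_deriveN; exact: dG.
  have [|e e0 he] := derive_gt0_increasing_at dN; first by rewrite oppr_gt0.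
  have := (he (h1 + e / 2)).1 ltac:(lra).
  have := pos (h1 + e / 2) ltac:(lra); lra.
have [e e0 he] := derive_gt0_increasing_at (dG _ h10) G1_gt0.
pose d := Num.min (e / 2) (h1 / 2).
have [d0 de dh] : [/\ 0 < d, d <= e / 2 & d <= h1 / 2].
  rewrite /d lt_min !ge_min !lexx !orbT; split => //.
  by rewrite !divr_gt0.
clearbody d.
have Gd := (he (h1 - d)).2 ltac:(lra); rewrite Gh1 in Gd.
have cG' z : 0 < z < h1 -> {for z, continuous G} by move=> zI; apply: cG; lra.
have [c cI Gc] := zero_between cG' (x := h1 - d) (y := h) ltac:(lra) ltac:(lra) (ltW Gd) Gh.
have := Guniq c ltac:(lra) Gc; lra.
Qed.

Lemma near_gt0 x : 0 < x -> \forall y \near x, 0 < y.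
Proof. by move=> x0; apply: lt_nbhsr. Qed.

End RealFunctions.

Section Wstar.
Context {R : realType}.
Variables (W : R -> R) (gam kap : R).
Hypothesis hW : stored_energy W gam kap.
Implicit Types (H x y z : R).

Notation V := (Wstarr W).
Notation V1 := ((Wstarr W)^`()%classic).
Notation V2 := ((Wstarr W)^`(2)%classic).

Lemma WstarE H : 0 < H -> Wstar W H = (V H)%:E.
Proof. by move=> H0; rewrite /Wstarr /= /Wstar H0. Qed.

Let W_derivable (k : nat) x : (k < 3)%N -> 0 < x ->
  is_derive x 1 (W^`(k)%classic) (W^`(k.+1)%classic x).
Proof. by move=> k3 x0; split; [exact: (W_C3 hW).1|rewrite derive1nS derive1E]. Qed.

Let dinv x : 0 < x -> is_derive x 1 (fun H : R => H^-1) (- (x ^+ 2)^-1).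
Proof.
move=> x0; have := @is_deriveV R id x 1 1 (lt0r_neq0 x0) (is_derive_id x 1).
by rewrite /GRing.scale /= mulr1.
Qed.

Let dcomp (k : nat) x : (k < 3)%N -> 0 < x ->
  is_derive x 1 (fun H : R => W^`(k)%classic H^-1) (W^`(k.+1)%classic x^-1 * - (x ^+ 2)^-1).
Proof.
move=> k3 x0; have xV0 : 0 < x^-1 by rewrite invr_gt0.
exact: (@is_derive1_comp R (W^`(k)%classic) (fun H : R => H^-1) x _ _ (W_derivable k3 xV0) (dinv x0)).
Qed.

Lemma Wstarr_derive H : 0 < H ->
  is_derive H 1 V (W H^-1 - W^`()%classic H^-1 / H).
Proof.
move=> H0; have Hn := lt0r_neq0 H0.
apply: (near_eq_is_derive (f := fun H => H * W H^-1)).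
  have := near_gt0 H0; apply: filterS => y y0; by rewrite /Wstarr /= /Wstar y0.
have := @dcomp 0 H isT H0 => /= h; apply: is_derive_eq; rewrite /GRing.scale /=.
by field.
Qed.

Lemma V1E H : 0 < H -> V1 H = W H^-1 - W^`()%classic H^-1 / H.
Proof. by move=> /Wstarr_derive /is_derive_val. Qed.

Lemma V_derive H : 0 < H -> is_derive H 1 V (V1 H).
Proof. by move=> H0; rewrite V1E //; exact: Wstarr_derive. Qed.

Let V1_derive_explicit H : 0 < H ->
  is_derive H 1 V1 (W^`(2)%classic H^-1 / H ^+ 3).
Proof.
move=> H0; have Hn := lt0r_neq0 H0.
apply: (near_eq_is_derive (f := fun H => W H^-1 - W^`()%classic H^-1 / H)).
  have := near_gt0 H0; apply: filterS => y y0; by rewrite V1E.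
have := @dcomp 0 H isT H0 => /= h; have := @dcomp 1 H isT H0 => /= h1.
have := dinv H0 => h2.
apply: is_derive_eq; rewrite /GRing.scale /=.
by field.
Qed.

Lemma V2E H : 0 < H -> V2 H = W^`(2)%classic H^-1 / H ^+ 3.
Proof. by move=> /V1_derive_explicit /is_derive_val. Qed.

Lemma V1_derive H : 0 < H -> is_derive H 1 V1 (V2 H).
Proof. by move=> H0; rewrite V2E //; exact: V1_derive_explicit. Qed.

Lemma V2_derivable H : 0 < H -> is_derive H 1 V2 (V2^`()%classic H).
Proof.
move=> H0; have Hn := lt0r_neq0 H0; split; last by rewrite derive1E.
apply: (near_eq_derivable (f := fun H => W^`(2)%classic H^-1 / H ^+ 3)).
  have := near_gt0 H0; apply: filterS => y y0; by rewrite V2E.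
have h := @dcomp 2 H isT H0.
have h2 : is_derive H 1 (fun H : R => (H ^+ 3)^-1) (- (H ^+ 3) ^- 2 *: (H ^+ 2 *+ 3)).
  apply: is_deriveV; first by rewrite expf_neq0.
  by apply: is_derive_eq; rewrite /GRing.scale /=; ring.
by case: (is_deriveM h h2).
Qed.

Lemma V2_continuous H : 0 < H -> {for H, continuous V2}.
Proof. by move=> /V2_derivable /is_derive_continuous. Qed.

(** If the second derivative were negative at x, a Taylor expansion would put the
    midpoint of a small chord strictly above it, against convexity. *)
Lemma W2_ge0 x : 0 < x -> x < kap^-1 -> 0 <= W^`(2)%classic x.
Proof.
move=> x0 xk; rewrite leNgt; apply/negP => lt0.
set m := W^`(2)%classic x / 2.
have m0 : W^`(2)%classic x < m by rewrite /m; lra.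
have cW2 := is_derive_continuous (@W_derivable 2 x isT x0).
have nr : \forall z \near x, W^`(2)%classic z < m by exact: (cvgr_lt _ cW2 m m0).
move/nbhs_ballP : nr => [d /= d0 hd].
pose e := Num.min d (Num.min x (kap^-1 - x)).
have [e0 ed ex ek] : [/\ 0 < e, e <= d, e <= x & e <= kap^-1 - x].
  by rewrite /e !lt_min !ge_min !lexx !orbT d0 x0 /= subr_gt0 xk.
have pos z : x - e < z < x + e -> 0 < z by lra.
have hdW z : x - e < z < x + e -> is_derive z 1 W (W^`()%classic z).
  by move=> /pos; exact: (@W_derivable 0 z isT).
have hdW1 z : x - e < z < x + e -> is_derive z 1 (W^`()%classic) (W^`(2)%classic z).
  by move=> /pos; exact: (@W_derivable 1 z isT).
have hm z : x - e < z < x + e -> W^`(2)%classic z <= m.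
  by move=> zI; apply/ltW/hd; rewrite /ball /= ltr_norml; lra.
have t1 := @taylor2_le R _ _ _ (x - e) (x + e) m x (x + e / 2) hdW hdW1 hm ltac:(lra) ltac:(lra).
have t2 := @taylor2_le R _ _ _ (x - e) (x + e) m x (x - e / 2) hdW hdW1 hm ltac:(lra) ltac:(lra).
have := W_convex hW (x := x + e / 2) (y := x - e / 2) (t := 1 / 2).
rewrite /= !in_itv /=.
move=> /(_ ltac:(lra) ltac:(lra) ltac:(by apply/eqP; lra) ltac:(lra) ltac:(lra)).
have -> : 1 / 2 * (x + e / 2) + (1 - 1 / 2) * (x - e / 2) = x by field.
have m00 : m < 0 by rewrite /m; lra.
have : m * e ^+ 2 < 0 by rewrite nmulr_rlt0 // exprn_gt0.
by nra.
Qed.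

Lemma V2_ge0 H : kap < H -> 0 <= V2 H.
Proof.
move=> kH; have k0 := W_kap_gt0 hW; have H0 : 0 < H := lt_trans k0 kH.
rewrite V2E // divr_ge0 ?exprn_ge0 ?(ltW H0) // W2_ge0 ?invr_gt0 //.
by rewrite ltf_pV2.
Qed.

End Wstar.

Section CharacteristicSign.
Context {R : realType}.
Variables (W : R -> R) (gam kap eps : R) (lam1 : R).
Hypothesis hW : stored_energy W gam kap.
Hypothesis heps : 0 < eps.
Hypothesis hlam0 : 0 < lam1.
Hypothesis hroot : char_eq eps W 1 lam1.
Hypothesis huniq : forall x : R, 0 < x -> char_eq eps W 1 x -> x = lam1.
Hypothesis htrans : char_transversal eps W 1 lam1.
Implicit Types (h : R).

(** Up to the factor lambda^2/2 with lambda = 1/h, the second variation of the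
    energy at 0 in the direction cos (pi s). *)
Definition stiffness (eps : R) (W : R -> R) (h : R) : R :=
  eps * pi ^+ 2 * h ^+ 2 + (Wstarr W)^`(2)%classic h.

Notation G := (stiffness eps W).
Notation h1 := lam1^-1.

Let h10 : 0 < h1. Proof. by rewrite invr_gt0. Qed.

Lemma stiffness_derive h : 0 < h -> is_derive h 1 G (G^`()%classic h).
Proof.
move=> h0; have d2 := V2_derivable hW h0.
have d1 : is_derive h 1 (fun h : R => eps * pi ^+ 2 * h ^+ 2) (eps * pi ^+ 2 * (h *+ 2)).
  by apply: is_derive_eq; rewrite /GRing.scale /=; ring.
have d := is_deriveD d1 d2.
by have := is_derive_val d => e; rewrite -e in d; exact: d.
Qed.

Lemma stiffness_eq0 h : 0 < h -> G h = 0 -> h = h1.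
Proof.
move=> h0 Gh; rewrite -[h]invrK; congr (_^-1); apply: huniq; first by rewrite invr_gt0.
rewrite /char_eq invrK expr1n mulr1 exprVn invrK.
by apply/eqP; rewrite -addr_eq0; apply/eqP.
Qed.

Lemma stiffness_h1 : G h1 = 0.
Proof.
have := hroot; rewrite /char_eq expr1n mulr1 /stiffness exprVn => ->.
by rewrite addNr.
Qed.

Lemma stiffness_derive_h1 : G^`()%classic h1 != 0.
Proof.
apply/eqP => e; apply: htrans.
have d2 := V2_derivable hW h10.
have d1 : is_derive h1 1 (fun h : R => eps * 1%:R ^+ 2 * pi ^+ 2 * h ^+ 2)
   ((fun h : R => eps * 1%:R ^+ 2 * pi ^+ 2 * h ^+ 2)^`()%classic h1).
  have d : is_derive h1 1 (fun h : R => eps * 1%:R ^+ 2 * pi ^+ 2 * h ^+ 2)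
      (eps * 1%:R ^+ 2 * pi ^+ 2 * (h1 *+ 2)).
    by apply: is_derive_eq; rewrite /GRing.scale /=; ring.
  by rewrite (is_derive_val d).
have eG : G = (fun h : R => eps * 1%:R ^+ 2 * pi ^+ 2 * h ^+ 2) + (Wstarr W)^`(2)%classic.
  by apply/funext => h; rewrite /stiffness !fctE expr1n mulr1.
rewrite (is_derive_val (is_deriveN d2)); apply/eqP; rewrite -addr_eq0; apply/eqP.
by rewrite -e eG (is_derive_val (is_deriveD d1 d2)).
Qed.

Lemma stiffness_signs :
  (forall h, h1 < h -> 0 < G h) /\ (forall h, 0 < h -> h < h1 -> G h < 0).
Proof.
have GK h : 0 < h -> kap < h -> 0 < G h.
  move=> h0 kh; rewrite /stiffness ltr_wpDr ?(V2_ge0 hW kh) //.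
  by rewrite !mulr_gt0 ?pi_gt0.
exact: (simple_zero_signs h10 stiffness_derive stiffness_h1 stiffness_derive_h1
  stiffness_eq0 GK).
Qed.

Lemma stiffness_gt0 h : h1 < h -> 0 < G h.
Proof. exact: stiffness_signs.1. Qed.

Lemma stiffness_lt0 h : 0 < h -> h < h1 -> G h < 0.
Proof. exact: stiffness_signs.2. Qed.

End CharacteristicSign.

(** * Energy and variational integral through representatives *)

Section Space.
Context {R : realType}.
Implicit Types (f g h u v w F q p k : R -> R) (a b x y s t z l : R).
Notation mu := (@lebesgue_measure R).
Local Notation I01 := (`](0 : R), 1[%classic).

Lemma weak_derivative_wderiv u : H1 u -> weak_derivative u (wderiv u).
Proof. by case=> _ _; exact: wderivP. Qed.

Lemma H1_within u : H1 u -> {within `[0, 1], continuous u}.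
Proof. by case. Qed.

Lemma HH_int01 u : HH u -> int01 u = 0.
Proof.
move=> [hu]; rewrite Rintegral_cc_oo //.
by have [_ [mu01 _] _] := hu.
Qed.

Lemma H1_intro u g : {within `[0, 1], continuous u} -> weak_derivative u g -> H1 u.
Proof. by move=> cu ug; split; [exact: cu|exact: within_sqi|exists g]. Qed.

Lemma HH_intro u g : {within `[0, 1], continuous u} -> weak_derivative u g ->
  int01 u = 0 -> HH u.
Proof.
move=> cu ug u0; split; first exact: H1_intro ug.
by rewrite Rintegral_cc_oo //; case: (within_sqi cu).
Qed.

Lemma weak_derivative_cst (c : R) : weak_derivative (fun=> c) (fun=> 0).
Proof.
by apply: C1_weak_derivative; exact: cst_continuous.
Qed.

Lemma KK_0 : KK (fun=> 0 : R).
Proof.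
split; last by move=> s _; rewrite lerN10.
apply: (HH_intro _ (weak_derivative_cst 0)); first by apply: continuous_within; exact: cst_continuous.
exact: int01_cst.
Qed.

Lemma int01_ae_sqr f g : square_integrable f -> square_integrable g ->
  ae_eq mu I01 f g -> int01 (fun s => f s ^+ 2) = int01 (fun s => g s ^+ 2).
Proof.
move=> [mf _] [mg _] fg; apply: int01_ae; try exact: measurable_funX.
by apply: filterS fg => s /= h /h ->.
Qed.

Lemma HH_normE u g : weak_derivative u g -> HH_norm u = Num.sqrt (int01 (fun s => g s ^+ 2)).
Proof.
move=> ug; have w1 := wderivP (ex_intro _ g ug).
rewrite /HH_norm /HH_inner Rintegral_cc_oo; last first.
  by case: w1 => -[mw _] _; exact: measurable_funM.
congr Num.sqrt; rewrite -(int01_ae_sqr _ _ (wderiv_ae ug)); try by case: w1; case: ug.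
Qed.

(** A function of mean zero is at each point the average of its differences with
    its other values, and these are bounded by the integral of |g|. *)
Lemma HH_sup_bound u g : {within `[0, 1], continuous u} -> weak_derivative u g ->
  int01 u = 0 -> forall s, 0 <= s <= 1 -> `|u s| <= Num.sqrt (int01 (fun s => g s ^+ 2)).
Proof.
move=> cu ug u0; have [U cU Uu] := within_extend cu.
have sg : square_integrable g by case: ug.
set m := Num.sqrt _.
have m1 : int01 (fun s => `|g s|) <= m.
  have J0 : 0 <= int01 (fun s => `|g s|) by apply: int01_ge0.
  by rewrite -(ger0_norm J0) -sqrtr_sqr ler_wsqrtr // int01_sqr_ge.
have inner s : 0 < s < 1 -> `|U s| <= m.
  move=> sI; rewrite Uu; last lra.
  have iu := sqi_itg (within_sqi cu).
  have -> : u s = int01 (fun y => u s - u y).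
    by rewrite (int01B (itg01_cst _) iu) int01_cst u0 subr0.
  have iD := itg01B (itg01_cst (u s)) iu.
  rewrite (le_trans (int01_norm iD)) // -[leRHS]int01_cst; apply: int01_le.
  - exact: itg01_norm.
  - exact: itg01_cst.
  - by move=> y yI; rewrite (le_trans (weak_derivative_oscillation cu ug sI yI)).
have cnU : continuous (fun s => `|U s|) by move=> x; apply: cvg_norm; exact: cU.
by move=> s sI; rewrite -Uu //; exact: (continuous_closure_le cnU inner).
Qed.

Lemma within_comp_scaled F u l : (forall x, 0 < x -> {for x, continuous F}) ->
  0 < l -> {within `[0, 1], continuous u} -> (forall s, 0 <= s <= 1 -> 0 < 1 + u s) ->
  {within `[0, 1], continuous (fun s => F ((1 + u s) / l))}.
Proof.
move=> cF l0 /subspace_continuousP cu up; apply/subspace_continuousP => s sI.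
apply: (@cvg_comp _ _ _ (fun s => (1 + u s) / l) F); last first.
  apply: cF; rewrite divr_gt0 // up //.
by apply: cvgMr_tmp; apply: cvgD; [exact: cvg_cst|exact: cu].
Qed.

End Space.

Section Energy.
Context {R : realType}.
Variables (W : R -> R) (gam kap eps : R).
Hypothesis hW : stored_energy W gam kap.
Implicit Types (g h u v w k : R -> R) (s t l : R).
Notation mu := (@lebesgue_measure R).
Local Notation I01 := (`](0 : R), 1[%classic).
Notation V := (Wstarr W).
Notation V1 := ((Wstarr W)^`()%classic).

Let dens l u g s := eps / 2 * g s ^+ 2 + l ^+ 4 * V ((1 + u s) / l).

Lemma V_continuous x : 0 < x -> {for x, continuous V}.
Proof. by move=> /(V_derive hW) /is_derive_continuous. Qed.

Lemma V1_continuous x : 0 < x -> {for x, continuous V1}.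
Proof. by move=> /(V1_derive hW) /is_derive_continuous. Qed.

(** Strict positivity of 1 + u keeps the integrand finite, and the choice of the
    weak derivative is immaterial. *)
Lemma energyE l u g : 0 < l -> {within `[0, 1], continuous u} -> weak_derivative u g ->
  (forall s, 0 <= s <= 1 -> 0 < 1 + u s) ->
  itg01 (fun s => V ((1 + u s) / l)) /\
  energy eps W l u = (eps / 2 * int01 (fun s => g s ^+ 2) +
                      l ^+ 4 * int01 (fun s => V ((1 + u s) / l)))%:E.
Proof.
move=> l0 cu ug up; have sV := within_sqi (within_comp_scaled V_continuous l0 cu up).
have iV := sqi_itg sV; split => //.
have w1 := wderivP (ex_intro _ g ug).
have sw : square_integrable (wderiv u) by case: w1.
have sg : square_integrable g by case: ug.
have iw2 : itg01 (fun s => wderiv u s ^+ 2) by case: sw.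
have iD := itg01D (itg01Z (eps / 2) iw2) (itg01Z (l ^+ 4) iV).
rewrite /energy.
transitivity (\int[mu]_(s in `[0%R, 1%R]) (dens l u (wderiv u) s)%:E)%E.
  apply: eq_integral => s; rewrite inE /= in_itv /= => sI.
  by rewrite WstarE ?divr_gt0 ?up // -EFinM -EFinD.
rewrite integral_itv_bndoo; last exact: (measurable_int mu iD).
rewrite -(int01_ae_sqr sw sg (wderiv_ae ug)).
rewrite -(int01Z _ iw2) -(int01Z _ iV) -int01D; [|exact: itg01Z|exact: itg01Z].
by rewrite /int01 /Rintegral fineK // integrable_fin_num.
Qed.

Lemma variational_integralE l u v gu gw : 0 < l ->
  {within `[0, 1], continuous u} -> {within `[0, 1], continuous v} ->
  weak_derivative u gu -> weak_derivative (v \- u) gw ->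
  (forall s, 0 <= s <= 1 -> 0 < 1 + u s) ->
  let k := fun s => V1 ((1 + u s) / l) in
  [/\ itg01 (fun s => gu s * gw s), itg01 (fun s => k s * (v s - u s)) &
   \int[mu]_(s in `[0, 1])
           (eps * wderiv u s * wderiv (v \- u) s
            + l ^+ 3 * dWstar W ((1 + u s) / l) * (v s - u s)) =
   eps * int01 (fun s => gu s * gw s) + l ^+ 3 * int01 (fun s => k s * (v s - u s))].
Proof.
move=> l0 cu cv ug wg up k.
have sk := within_sqi (within_comp_scaled V1_continuous l0 cu up).
have [sgu sgw] : square_integrable gu /\ square_integrable gw by case: ug; case: wg.
have svu : square_integrable (fun s => v s - u s) by apply: sqiB; exact: within_sqi.
have i1 := sqi_mul sgu sgw; have i2 : itg01 (fun s => k s * (v s - u s)) := sqi_mul sk svu.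
split => //.
have kE s : 0 < s < 1 -> dWstar W ((1 + u s) / l) = k s.
  by move=> sI; rewrite /dWstar divr_gt0 // up //; lra.
have [[mwu _] _] := wderivP (ex_intro _ gu ug).
have [[mww _] _] := wderivP (ex_intro _ gw wg).
have mk : measurable_fun I01 (fun s => dWstar W ((1 + u s) / l)).
  have [mk _] := sk; apply: eq_measurable_fun mk => s.
  by rewrite inE /= in_itv /= => /kE ->.
have mvu : measurable_fun I01 (fun s => v s - u s) by case: svu.
have mL : measurable_fun I01 (fun s => eps * wderiv u s * wderiv (v \- u) s
            + l ^+ 3 * dWstar W ((1 + u s) / l) * (v s - u s)).
  by apply: measurable_funD; apply: measurable_funM => //; apply: measurable_funM.
rewrite Rintegral_cc_oo // -(int01Z _ i1) -(int01Z _ i2) -int01D; [|exact: itg01Z|exact: itg01Z].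
apply: int01_ae => //.
  exact: itg01_measurable (itg01D (itg01Z _ i1) (itg01Z _ i2)).
have a1 := wderiv_ae ug; have a2 := wderiv_ae wg.
apply: filterS2 a1 a2 => s /= h1 h2 sI; rewrite (h1 sI) (h2 sI) kE.
  by rewrite !mulrA.
by move: sI; rewrite in_itv.
Qed.

End Energy.

(** * Stability and instability of the trivial solution *)

Section Stability.
Context {R : realType}.
Variables (W : R -> R) (gam kap eps : R).
Hypothesis hW : stored_energy W gam kap.
Hypothesis heps : 0 < eps.
Implicit Types (f g u v w : R -> R) (s t l h k m x y rho : R).
Notation V := (Wstarr W).
Notation V1 := ((Wstarr W)^`()%classic).
Notation V2 := ((Wstarr W)^`(2)%classic).

Lemma lower_bound_near f h m : {for h, continuous f} -> 0 < h -> m < f h ->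
  exists2 rho, 0 < rho <= h & forall k, h - rho < k < h + rho -> m <= f k.
Proof.
move=> cf h0 mh.
have nr : \forall k \near h, m < f k by exact: (cvgr_gt (f h) cf m mh).
move/nbhs_ballP : nr => [d /= d0 hd].
exists (Num.min d h); first by rewrite lt_min d0 h0 ge_min lexx orbT.
have : Num.min d h <= d by rewrite ge_min lexx.
set e := Num.min d h => ed k kI.
by apply/ltW/hd; rewrite /ball /= ltr_norml; lra.
Qed.

Lemma upper_bound_near f h m : {for h, continuous f} -> 0 < h -> f h < m ->
  exists2 rho, 0 < rho <= h & forall k, h - rho < k < h + rho -> f k <= m.
Proof.
move=> cf h0 mh; have cN : {for h, continuous (fun x => - f x)} by apply: continuousN.
have [|rho r0 hr] := @lower_bound_near (fun x => - f x) h (- m) cN h0; first by rewrite ltrN2.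
by exists rho => // k /hr; rewrite lerN2.
Qed.

Section Taylor.
Variables (l h rho m : R) (v g : R -> R).
Hypothesis (l0 : 0 < l) (hl : l * h = 1) (r0 : 0 < rho <= h).
Hypothesis cv : {within `[0, 1], continuous v}.
Hypothesis v0 : int01 v = 0.
Hypothesis vs : forall s, 0 <= s <= 1 -> `|v s| * h < rho.

Let h0 : 0 < h.
Proof. by rewrite -(pmulr_rgt0 _ l0) hl. Qed.

Lemma div_scale x : x / l = x * h.
Proof. by rewrite (_ : h = l^-1) // -[h]mulr1 -(mulfV (lt0r_neq0 l0)) mulrA [h * l]mulrC hl mul1r. Qed.

(** The sup bound on v is what confines the argument of V to the interval where
    its second derivative is controlled. *)
Lemma small_argument_range s : 0 <= s <= 1 -> h - rho < (1 + v s) / l < h + rho.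
Proof.
move=> /vs; rewrite div_scale -{1}(ger0_norm (ltW h0)) -normrM ltr_norml mulrDl mul1r.
by lra.
Qed.

Lemma small_one_plus_gt0 s : 0 <= s <= 1 -> 0 < 1 + v s.
Proof.
move=> /small_argument_range; rewrite div_scale => /andP[h1 _].
by rewrite -(pmulr_lgt0 _ h0); case/andP: r0; lra.
Qed.

Let dV k : h - rho < k < h + rho -> is_derive k 1 V (V1 k).
Proof. by move=> kI; apply: (V_derive hW); case/andP: r0; lra. Qed.

Let dV1 k : h - rho < k < h + rho -> is_derive k 1 V1 (V2 k).
Proof. by move=> kI; apply: (V1_derive hW); case/andP: r0; lra. Qed.

Let iv := sqi_itg (within_sqi cv).
Let iv2 : itg01 (fun s => v s ^+ 2). Proof. by case: (within_sqi cv). Qed.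

(** The linear term of the expansion disappears because v has mean zero. *)
Lemma int_quadratic_model : itg01 (fun s => V h + V1 h * h * v s + m / 2 * h ^+ 2 * v s ^+ 2) /\
  int01 (fun s => V h + V1 h * h * v s + m / 2 * h ^+ 2 * v s ^+ 2) =
  V h + m / 2 * h ^+ 2 * int01 (fun s => v s ^+ 2).
Proof.
have i1 := itg01Z (V1 h * h) iv; have i2 := itg01Z (m / 2 * h ^+ 2) iv2.
have i0 := itg01_cst (V h); have i01 := itg01D i0 i1.
split; first exact: (itg01D i01 i2).
by rewrite (int01D i01 i2) (int01D i0 i1) int01_cst !int01Z // v0 mulr0 addr0.
Qed.

Let point_eq s : h + (v s) * h = (1 + v s) / l. Proof. by rewrite div_scale; ring. Qed.

Let iV : itg01 (fun s => V ((1 + v s) / l)).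
Proof.
apply/sqi_itg/within_sqi/(within_comp_scaled _ l0 cv small_one_plus_gt0) => x.
exact: (V_continuous hW).
Qed.

Lemma int_V_ge : (forall k, h - rho < k < h + rho -> m <= V2 k) ->
  V h + m / 2 * h ^+ 2 * int01 (fun s => v s ^+ 2) <= int01 (fun s => V ((1 + v s) / l)).
Proof.
move=> hm; have [iq <-] := int_quadratic_model; apply: int01_le => // s sI.
have sI' : 0 <= s <= 1 by lra.
have hI : h - rho < h < h + rho by case/andP: r0; lra.
have := taylor2_ge dV dV1 hm hI (small_argument_range sI').
have -> : (1 + v s) / l - h = v s * h by rewrite -point_eq; ring.
by congr (_ <= _); ring.
Qed.

Lemma int_V_le : (forall k, h - rho < k < h + rho -> V2 k <= m) ->
  int01 (fun s => V ((1 + v s) / l)) <= V h + m / 2 * h ^+ 2 * int01 (fun s => v s ^+ 2).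
Proof.
move=> hm; have [iq <-] := int_quadratic_model; apply: int01_le => // s sI.
have sI' : 0 <= s <= 1 by lra.
have hI : h - rho < h < h + rho by case/andP: r0; lra.
have := taylor2_le dV dV1 hm hI (small_argument_range sI').
have -> : (1 + v s) / l - h = v s * h by rewrite -point_eq; ring.
by congr (_ <= _); ring.
Qed.

(** First-order counterpart of [int_V_ge], for the variational inequality: the
    constant V1 h contributes nothing, again by the mean-zero condition. *)
Lemma int_V1_ge : (forall k, h - rho < k < h + rho -> m <= V2 k) ->
  m * h * int01 (fun s => v s ^+ 2) <= int01 (fun s => V1 ((1 + v s) / l) * v s).
Proof.
move=> hm.
have iV1 : itg01 (fun s => V1 ((1 + v s) / l) * v s).
  apply: sqi_mul; last exact: within_sqi.
  apply/within_sqi/(within_comp_scaled _ l0 cv small_one_plus_gt0) => x.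
  exact: (V1_continuous hW).
have i2 := itg01Z (m * h) iv2; have i1 := itg01Z (V1 h) iv.
have -> : m * h * int01 (fun s => v s ^+ 2) = int01 (fun s => m * h * v s ^+ 2 + V1 h * v s).
  by rewrite (int01D i2 i1) (int01Z _ iv2) (int01Z _ iv) v0 mulr0 addr0.
apply: (int01_le (itg01D i2 i1) iV1).
move=> s sI; have sI' : 0 <= s <= 1 by lra.
have hI : h - rho < h < h + rho by case/andP: r0; lra.
have [z [zI _ _ e]] := mvt_between dV1 hI (small_argument_range sI').
move: e; have -> : (1 + v s) / l - h = v s * h by rewrite -point_eq; ring.
move=> /eqP; rewrite subr_eq => /eqP ->; have := hm _ zI => mz.
rewrite mulrDl lerD2r -subr_ge0.
have -> : V2 z * (v s * h) * v s - m * h * v s ^+ 2 = (V2 z - m) * h * v s ^+ 2 by ring.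
apply: mulr_ge0; last exact: sqr_ge0.
by apply: mulr_ge0; [rewrite subr_ge0|exact: ltW].
Qed.

End Taylor.

Lemma energy_0 l : 0 < l -> energy eps W l (fun=> 0) = (l ^+ 4 * V l^-1)%:E.
Proof.
move=> l0; have c0 : {within `[0, 1], continuous ((fun=> 0) : R -> R)}.
  by apply: continuous_within; exact: cst_continuous.
have [|_ ->] := energyE eps hW l0 c0 (weak_derivative_cst 0); first by move=> s _; lra.
congr EFin.
rewrite (_ : (fun s => (0 : R) ^+ 2) = (fun=> 0)); last by apply/funext => s; rewrite expr0n.
by rewrite !int01_cst mulr0 add0r addr0 div1r.
Qed.

Lemma KK_facts v : KK v -> [/\ {within `[0, 1], continuous v}, weak_derivative v (wderiv v),
  int01 v = 0 & forall s, 0 <= s <= 1 -> -1 <= v s].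
Proof.
move=> [hv v1]; have h1 := hv.1; split.
- exact: H1_within.
- exact: weak_derivative_wderiv.
- exact: HH_int01.
- by move=> s sI; apply: v1; rewrite inE /= in_itv.
Qed.

Lemma sub_fun0 v : v \- (fun=> 0) = v.
Proof. by apply/funext => s /=; rewrite subr0. Qed.

Lemma trivial_equilibrium l : 0 < l -> equilibrium eps W l (fun=> 0).
Proof.
move=> l0; split; first exact: KK_0.
move=> v /KK_facts [cv wv v0 _].
have c0 : {within `[0, 1], continuous ((fun=> 0) : R -> R)}.
  by apply: continuous_within; exact: cst_continuous.
have wv' : weak_derivative (v \- (fun=> 0)) (wderiv v) by rewrite sub_fun0.
have [|_ i2 ->] := variational_integralE eps hW l0 c0 cv (weak_derivative_cst 0) wv'.
  by move=> s _; lra.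
rewrite (@int01_eq R (fun s => 0 * wderiv v s) (fun=> 0)); last by move=> s _; rewrite mul0r.
rewrite int01_cst mulr0 add0r.
rewrite (@int01_eq R _ (fun s => V1 (1 / l) * v s)); last by move=> s _; rewrite addr0 subr0.
by rewrite int01Z ?v0 ?mulr0 //; apply: sqi_itg; exact: within_sqi.
Qed.

Lemma stable_of_stiffness l : 0 < l -> 0 < stiffness eps W l^-1 ->
  locally_stable eps W l (fun=> 0).
Proof.
move=> l0 G0; split; first exact: trivial_equilibrium.
have hl : l * l^-1 = 1 by rewrite mulfV // lt0r_neq0.
have E0 := energy_0 l0.
have h0 : 0 < l^-1 by rewrite invr_gt0.
move: l^-1 hl G0 E0 h0 => h hl G0 E0 h0.
have [|rho r0 hr] := @lower_bound_near V2 h (- (eps * pi ^+ 2 * h ^+ 2)) (V2_continuous hW h0) h0.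
  by move: G0; rewrite /stiffness; lra.
exists (rho * l); first by rewrite mulr_gt0 //; case/andP: r0.
move=> v /KK_facts [cv wv v0 _]; rewrite sub_fun0 (HH_normE wv) => nv.
have vs s : 0 <= s <= 1 -> `|v s| * h < rho.
  move=> sI; have := le_lt_trans (HH_sup_bound cv wv v0 sI) nv.
  by rewrite -(ltr_pM2r h0) -mulrA hl mulr1.
have [|_ ->] := energyE eps hW l0 cv wv; first exact: (small_one_plus_gt0 l0 hl r0 vs).
rewrite E0 lee_fin.
have := int_V_ge l0 hl r0 cv v0 vs hr.
have := neumann_poincare cv wv v0.
set J := int01 (fun s => v s ^+ 2); set D := int01 (fun s => wderiv v s ^+ 2).
set I := int01 _; move=> p1 p2.
have l4 : 0 < l ^+ 4 by rewrite exprn_gt0.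
have : l ^+ 4 * (V h + - (eps * pi ^+ 2 * h ^+ 2) / 2 * h ^+ 2 * J) <= l ^+ 4 * I by rewrite ler_pM2l.
have -> : l ^+ 4 * (V h + - (eps * pi ^+ 2 * h ^+ 2) / 2 * h ^+ 2 * J) =
  l ^+ 4 * V h - eps / 2 * (pi ^+ 2 * J) * (l * h) ^+ 4 by field.
rewrite hl expr1n mulr1.
have : eps / 2 * (pi ^+ 2 * J) <= eps / 2 * D by rewrite ler_pM2l // divr_gt0.
by lra.
Qed.

End Stability.

Section Instability.
Context {R : realType}.
Variables (W : R -> R) (gam kap eps : R).
Hypothesis hW : stored_energy W gam kap.
Hypothesis heps : 0 < eps.
Implicit Types (f g u v w : R -> R) (s t l h k m x y rho : R).
Notation V := (Wstarr W).
Notation V1 := ((Wstarr W)^`()%classic).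
Notation V2 := ((Wstarr W)^`(2)%classic).


Let cosine t s := t * cos (pi * s + 0).
Let cosine' t s := - (t * pi) * sin (pi * s + 0).

Lemma is_derive_cosine t s : is_derive s 1 (cosine t) (cosine' t s).
Proof.
have d := is_derive_affine (f := cos) (a := pi) (b := 0) (x := s) (is_derive_cos _).
by apply: is_derive_eq; rewrite /GRing.scale /= /cosine'; ring.
Qed.

Lemma is_derive_sine t s : is_derive s 1 (fun s => t * sin (pi * s + 0)) (t * pi * cos (pi * s + 0)).
Proof.
have d := is_derive_affine (f := sin) (a := pi) (b := 0) (x := s) (is_derive_sin _).
by apply: is_derive_eq; rewrite /GRing.scale /=; ring.
Qed.

Lemma cosine_continuous t : continuous (cosine t).
Proof. by move=> s; exact: is_derive_continuous (is_derive_cosine t s). Qed.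

Lemma cosine'_continuous t : continuous (cosine' t).
Proof. by move=> s; exact: is_derive_continuous (is_derive_sine (- (t * pi)) s). Qed.

Lemma int01_cosine t : int01 (cosine t) = 0.
Proof.
have pi0 : pi != 0 :> R by rewrite gt_eqF // pi_gt0.
have dF s : is_derive s 1 (fun s => t / pi * sin (pi * s + 0)) (cosine t s).
  rewrite (_ : cosine t s = t / pi * pi * cos (pi * s + 0)); first exact: is_derive_sine.
  by rewrite /cosine divfK.
rewrite (FTC01 dF (@cosine_continuous t)).
by rewrite !addr0 mulr1 mulr0 sinpi sin0 mulr0 subrr.
Qed.

Lemma int01_cosine_sqr t : int01 (fun s => cosine t s ^+ 2) = t ^+ 2 / 2.
Proof.
have pi0 : pi != 0 :> R by rewrite gt_eqF // pi_gt0.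
have dF s : is_derive s 1 (fun s => t ^+ 2 / 2 * s +
    t / (2 * pi) * sin (pi * s + 0) * cosine t s) (cosine t s ^+ 2).
  have d := is_derive_sine (t / (2 * pi)) s; have d' := is_derive_cosine t s.
  apply: is_derive_eq; rewrite /GRing.scale /= /cosine /cosine'.
  have := cos2Dsin2 (pi * s + 0); set c := cos _; set e := sin _ => ce.
  have -> : t ^+ 2 / 2 * 1 = t ^+ 2 / 2 * (c ^+ 2 + e ^+ 2) by rewrite ce.
  clearbody c e; move: pi0; move: (pi : R) => p pn.
  by field.
rewrite (FTC01 dF (continuous_sqr (@cosine_continuous t))).
by rewrite !addr0 !mulr1 !mulr0 sinpi sin0 !mulr0 !mul0r; ring.
Qed.

Lemma int01_cosine'_sqr t : int01 (fun s => cosine' t s ^+ 2) = pi ^+ 2 * (t ^+ 2 / 2).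
Proof.
have i2 := continuous_itg01 (continuous_sqr (@cosine_continuous t)).
rewrite (@int01_eq R _ (fun s => (t * pi) ^+ 2 - pi ^+ 2 * cosine t s ^+ 2)); last first.
  move=> s _; rewrite /cosine /cosine'.
  have := cos2Dsin2 (pi * s + 0); set c := cos _; set e := sin _ => ce.
  have -> : (t * pi) ^+ 2 = (t * pi) ^+ 2 * (c ^+ 2 + e ^+ 2) by rewrite ce mulr1.
  by ring.
rewrite (int01B (itg01_cst _) (itg01Z _ i2)) (int01Z _ i2) int01_cst int01_cosine_sqr.
by move: (pi : R) => p; field.
Qed.

Lemma cosine_bound t s : 0 <= t -> `|cosine t s| <= t.
Proof.
move=> t0; rewrite /cosine normrM (ger0_norm t0) -[leRHS]mulr1 ler_wpM2l //.
by rewrite ler_norml cos_geN1 cos_le1.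
Qed.

(** For v = t cos (pi s) the Poincare inequality is an equality, so a negative
    stiffness, which persists near h by continuity, gives an energy drop of
    order t^2. *)
Lemma not_minimum_of_stiffness l : 0 < l -> stiffness eps W l^-1 < 0 ->
  ~ local_minimum eps W l (fun=> 0).
Proof.
move=> l0 G0 [d d0 hmin].
have hl : l * l^-1 = 1 by rewrite mulfV // lt0r_neq0.
have E0 := energy_0 eps hW l0.
have h0 : 0 < l^-1 by rewrite invr_gt0.
move: l^-1 hl G0 E0 h0 => h hl G0 E0 h0.
(* halfway between V2 h and the critical value - eps pi^2 h^2 *)
pose m := V2 h / 2 - eps * pi ^+ 2 * h ^+ 2 / 2.
have mh : V2 h < m by move: G0; rewrite /stiffness /m; lra.
have ml : m < - (eps * pi ^+ 2 * h ^+ 2) by move: G0; rewrite /stiffness /m; lra.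
have [rho r0 hr] := upper_bound_near (V2_continuous hW h0) h0 mh.
have pi0 := pi_gt0 R.
pose t := Num.min (Num.min (1 / 2) (d / (2 * pi))) (rho / (2 * h)).
have [t0 t1 td tr] : [/\ 0 < t, t <= 1 / 2, t <= d / (2 * pi) & t <= rho / (2 * h)].
  rewrite /t !lt_min !ge_min !lexx !orbT /=; split => //.
  by rewrite !divr_gt0 // ?mulr_gt0 //; case/andP: r0.
have tpi : t * pi < d.
  by move: td; rewrite ler_pdivlMr ?mulr_gt0 // => td; have : 0 < t * pi by [rewrite mulr_gt0]; lra.
have th : t * h < rho.
  by move: tr; rewrite ler_pdivlMr ?mulr_gt0 // => tr; have : 0 < t * h by [rewrite mulr_gt0]; lra.
have cv : {within `[0, 1], continuous (cosine t)}.
  by apply: continuous_within; exact: cosine_continuous.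
have wv : weak_derivative (cosine t) (cosine' t).
  by apply: C1_weak_derivative; [exact: is_derive_cosine|exact: cosine'_continuous].
have v0 := int01_cosine t.
have KKv : KK (cosine t).
  split; first exact: HH_intro wv v0.
  move=> s _; have := cosine_bound s (ltW t0); rewrite ler_norml => /andP[c1 _]; lra.
have vs s : 0 <= s <= 1 -> `|cosine t s| * h < rho.
  by move=> _; have cb := cosine_bound s (ltW t0); rewrite (le_lt_trans _ th) // ler_wpM2r // ltW.
have nv : HH_norm (cosine t \- (fun=> 0)) < d.
  rewrite sub_fun0 (HH_normE wv) int01_cosine'_sqr (le_lt_trans _ tpi) //.
  have tp0 : 0 <= t * pi by rewrite mulr_ge0 // ltW.
  rewrite -[leRHS](ger0_norm tp0) -[leRHS]sqrtr_sqr ler_wsqrtr //.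
  by have := sqr_ge0 (t * pi); rewrite exprMn; lra.
have := hmin _ KKv nv.
have [|_ ->] := energyE eps hW l0 cv wv; first exact: (small_one_plus_gt0 l0 hl r0 vs).
rewrite E0 lee_fin int01_cosine'_sqr.
have := int_V_le hW l0 hl r0 cv v0 vs hr; rewrite int01_cosine_sqr.
set I := int01 _ => p2.
have l4 : 0 < l ^+ 4 by rewrite exprn_gt0.
have : l ^+ 4 * I <= l ^+ 4 * (V h + m / 2 * h ^+ 2 * (t ^+ 2 / 2)) by rewrite ler_pM2l.
have : l ^+ 4 * (m / 2 * h ^+ 2 * (t ^+ 2 / 2)) <
       l ^+ 4 * (- (eps * pi ^+ 2 * h ^+ 2) / 2 * h ^+ 2 * (t ^+ 2 / 2)).
  by rewrite ltr_pM2l // !ltr_pM2r ?divr_gt0 ?exprn_gt0 // ?invr_gt0.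
have -> : l ^+ 4 * (- (eps * pi ^+ 2 * h ^+ 2) / 2 * h ^+ 2 * (t ^+ 2 / 2)) =
  - (eps / 2 * (pi ^+ 2 * (t ^+ 2 / 2)) * (l * h) ^+ 4) by field.
rewrite hl expr1n mulr1 mulrDr.
by lra.
Qed.

Lemma unstable_of_stiffness l : 0 < l -> stiffness eps W l^-1 < 0 ->
  unstable eps W l (fun=> 0).
Proof.
move=> l0 G0; have nl := not_minimum_of_stiffness l0 G0.
split => //; first exact: (trivial_equilibrium eps hW l0).
move=> gm; apply: nl; exists 1; first exact: ltr01.
by move=> v Kv _; exact: (gm v Kv).
Qed.

(** Testing with v = 0 gives eps int u'^2 + lambda^3 int V1 ((1 + u)/lambda) u <= 0.
    By the mean value theorem and the Poincare inequality the left side is at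
    least a positive multiple of int u^2 (the stiffness at 1/lambda, bounded
    below near 1/l0), so u vanishes. *)
Lemma no_small_equilibrium l0 : 0 < l0 -> 0 < stiffness eps W l0^-1 ->
  ~ bifurcation_point eps W l0.
Proof.
move=> l00 G0 [_ bif].
have h00 : 0 < l0^-1 by rewrite invr_gt0.
set h_ := l0^-1 in G0 h00.
(* one third each for the variation of V2, of eps pi^2 h^2, and for the remaining lower bound *)
pose q := stiffness eps W h_ / 3.
have q0 : 0 < q by rewrite divr_gt0.
have qE : stiffness eps W h_ = 3 * q by rewrite /q mulrC divfK // lt0r_neq0.
have [r1 r1I hr1] := lower_bound_near (V2_continuous hW h00) h00
  (ltac:(by rewrite ltrBlDr ltrDl) : V2 h_ - q < V2 h_).
have cq : {for h_, continuous (fun h => eps * pi ^+ 2 * h ^+ 2)}.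
  by apply: cvgMl_tmp; apply: cvgM; exact: cvg_id.
have [r2 r2I hr2] := lower_bound_near cq h00 (ltac:(by rewrite ltrBlDr ltrDl) :
  eps * pi ^+ 2 * h_ ^+ 2 - q < eps * pi ^+ 2 * h_ ^+ 2).
pose r := Num.min r1 r2.
have [rr0 rr1 rr2] : [/\ 0 < r, r <= r1 & r <= r2].
  by rewrite lt_min !ge_min !lexx orbT; case/andP: r1I => ->; case/andP: r2I => ->.
have nr : \forall l \near l0, `|l0^-1 - l^-1| < r / 2.
  have ci : {for l0, continuous (fun x : R => x^-1)} by apply: inv_continuous; exact: lt0r_neq0.
  by have /cvgrPdist_lt /(_ (r / 2)) := ci; apply; rewrite divr_gt0.
move/nbhs_ballP : nr => [d1 /= d10 hd1].
have rh : r <= h_ by case/andP: r1I => _; exact: le_trans.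
pose d := Num.min d1 (r / (4 * h_)).
have [d0 dd1 ddr] : [/\ 0 < d, d <= d1 & d <= r / (4 * h_)].
  by rewrite /d lt_min !ge_min !lexx !orbT d10 /= divr_gt0 // mulr_gt0.
have [l [u [lp ll0 [Ku eqv] nu [s0 s0I us0]]]] := bif d d0.
have {}hd1 : `|h_ - l^-1| < r / 2.
  by apply: hd1; rewrite /ball /= distrC (lt_le_trans ll0).
have hl : l * l^-1 = 1 by rewrite mulfV // lt0r_neq0.
have hp : 0 < l^-1 by rewrite invr_gt0.
have [cu wu ui _] := KK_facts Ku.
have c0 : {within `[0, 1], continuous ((fun=> 0) : R -> R)}.
  by apply: continuous_within; exact: cst_continuous.
have w0u := weak_derivative_sub cu c0 wu (weak_derivative_cst 0).
move: l^-1 hd1 hl hp => h hd1 hl hp.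
clearbody h_ r d q.
move: hd1; rewrite ltr_norml => /andP[hd1 hd2].
have rhoI : 0 < r / 2 <= h by apply/andP; split; lra.
have hu s : 0 <= s <= 1 -> `|u s| * h < r / 2.
  move=> sI; have := HH_sup_bound cu wu ui sI.
  rewrite -(HH_normE wu) => b1; have b2 := le_lt_trans b1 nu.
  have := ddr; rewrite ler_pdivlMr ?mulr_gt0 // => b3.
  by nra.
have := eqv _ KK_0.
have [|_ _ ->] := variational_integralE eps hW lp cu c0 wu w0u.
  exact: (small_one_plus_gt0 lp hl rhoI hu).
have hm k : h - r / 2 < k < h + r / 2 -> V2 h_ - q <= V2 k.
  by move=> kI; apply: hr1; lra.
have he : eps * pi ^+ 2 * h_ ^+ 2 - q <= eps * pi ^+ 2 * h ^+ 2 by apply: hr2; lra.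
have := int_V1_ge hW lp hl rhoI cu ui hu hm.
have := neumann_poincare cu wu ui.
set I := int01 (fun s => V1 ((1 + u s) / l) * u s).
have su := within_sqi cu; have [_ iu2] := su.
have swu : square_integrable (wderiv u) by case: wu.
have [_ iw2] := swu.
rewrite (@int01_eq R (fun s => wderiv u s * (0 - wderiv u s)) (fun s => -1 * wderiv u s ^+ 2)); last first.
  by move=> s _; ring.
rewrite (@int01_eq R (fun s => _ * (0 - u s)) (fun s => -1 * (V1 ((1 + u s) / l) * u s))); last first.
  by move=> s _; ring.
rewrite (int01Z _ iw2) int01Z; last first.
  apply: sqi_mul su; apply/within_sqi/(within_comp_scaled _ lp cu (small_one_plus_gt0 lp hl rhoI hu)) => x.
  exact: (V1_continuous hW).
rewrite -/I; set J := int01 (fun s => u s ^+ 2).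
set D := int01 (fun s => wderiv u s ^+ 2) => p1 p2 p3.
have J0 : 0 <= J by apply: int01_ge0 => s _; exact: sqr_ge0.
have l3 : 0 < l ^+ 3 by rewrite exprn_gt0.
have p4 : l ^+ 3 * ((V2 h_ - q) * h * J) <= l ^+ 3 * I by rewrite ler_pM2l.
have p5 : eps * (pi ^+ 2 * J) <= eps * D by rewrite ler_pM2l.
have p6 : eps * (pi ^+ 2 * J) + l ^+ 3 * ((V2 h_ - q) * h * J) <= 0 by lra.
have : h ^+ 2 * (eps * (pi ^+ 2 * J) + l ^+ 3 * ((V2 h_ - q) * h * J)) <= 0.
  by rewrite pmulr_rle0 // exprn_gt0.
have -> : h ^+ 2 * (eps * (pi ^+ 2 * J) + l ^+ 3 * ((V2 h_ - q) * h * J)) =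
  (eps * pi ^+ 2 * h ^+ 2 + (V2 h_ - q) * (l * h) ^+ 3) * J by ring.
rewrite hl expr1n mulr1 => p7.
have qpos : q <= eps * pi ^+ 2 * h ^+ 2 + (V2 h_ - q) by move: he qE; rewrite /stiffness; lra.
have JE : J = 0.
  apply/eqP; rewrite eq_le J0 andbT leNgt; apply/negP => Jp.
  by move: p7; apply/negP; rewrite -ltNge mulr_gt0 //; lra.
have [U cU Uu] := within_extend cu.
have JU : int01 (fun s => U s ^+ 2) = 0.
  by rewrite -JE; apply: int01_eq => s sI; rewrite Uu //; lra.
have s0I' : 0 <= s0 <= 1 by move: s0I; rewrite inE /= in_itv.
by move: us0; rewrite -Uu // (continuous_int01_sqr0 cU JU s0I') eqxx.
Qed.

End Instability.

(** * Bifurcation by quadrature *)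

Section ChordCurvature.
Context {R : realType}.
Variables (f f1 f2 : R -> R) (lo hi : R).
Hypothesis df : forall z : R, lo < z < hi -> is_derive z 1 f (f1 z).
Hypothesis df1 : forall z : R, lo < z < hi -> is_derive z 1 f1 (f2 z).
Implicit Types (a b c r x y z m M t : R).

(** Difference quotient, completed by the derivative so that it is continuous
    in x also at the base point. *)
Definition slope (f f1 : R -> R) (a x : R) : R :=
  if x == a then f1 a else (f x - f a) / (x - a).

(** Minus the second divided difference of f at c - r, c + r and x; it tends to
    - f''(c)/2 as r tends to 0. *)
Definition chord_curv (f f1 : R -> R) (c r x : R) : R :=
  (slope f f1 (c - r) x - slope f f1 (c + r) x) / (2 * r).

Definition chord (f : R -> R) (c r x : R) : R :=
  f (c - r) + (f (c + r) - f (c - r)) / (2 * r) * (x - (c - r)).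

Lemma near_eq_continuous (g h : R -> R) x : (\forall y \near x, g y = h y) ->
  {for x, continuous g} -> {for x, continuous h}.
Proof.
move=> gh cg; have e : g x = h x := nbhs_singleton gh.
have cg' : g @ x --> h x by rewrite -e; exact: cg.
by apply: cvg_trans cg'; apply: near_eq_cvg; exact: gh.
Qed.

Lemma near_in_itv x y z : x < y < z -> \forall t \near y, x < t < z.
Proof.
by move=> /andP[xy yz]; near=> t; apply/andP; split; near: t; [exact: lt_nbhsr|exact: lt_nbhsl].
Unshelve. all: by end_near. Qed.

Lemma slope_continuous a x : lo < a < hi -> lo < x < hi ->
  {for x, continuous (slope f f1 a)}.
Proof.
move=> aI xI; have [->|xa] := eqVneq x a; last first.
  apply: (near_eq_continuous (g := fun y => (f y - f a) / (y - a))).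
    apply/nbhs_ballP; exists `|x - a| => /=; first by rewrite normr_gt0 subr_eq0.
    move=> y; rewrite /ball /= /slope => yx; case: eqVneq => // ya.
    by move: yx; rewrite ya ltxx.
  have xa0 : x - a != 0 by rewrite subr_eq0.
  have cfx := is_derive_continuous (df xI).
  apply: cvgM; first by apply: cvgB; [exact: cfx|exact: cvg_cst].
  by apply: cvgV => //; apply: cvgB; [exact: cvg_id|exact: cvg_cst].
apply/cvgrPdist_lt => e e0.
have cf1 := is_derive_continuous (df1 aI).
have nr : \forall y \near a, `|f1 a - f1 y| < e by move/cvgrPdist_lt: cf1; apply.
move/nbhs_ballP : nr => [d /= d0 hd].
have nr1 : \forall y \near a, a - d < y < a + d by apply: near_in_itv; lra.
apply: filterS2 nr1 (near_in_itv aI) => y yd yI; rewrite /slope eqxx.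
have [_|ya] := eqVneq y a; first by rewrite subrr normr0.
have [z [zI z1 z2 ->]] := mvt_between df aI yI.
rewrite mulfK ?subr_eq0 //; apply: hd; rewrite /ball /=.
by rewrite ltr_norml; case/andP: yd => ??; apply/andP; split; nra.
Qed.

Section FixedChord.
Variables (c r : R).
Hypothesis (r0 : 0 < r) (loc : lo < c - r) (chi : c + r < hi).

Let rn : 2 * r != 0. Proof. by rewrite lt0r_neq0 // mulr_gt0. Qed.

Lemma chord_curv_continuous x : lo < x < hi ->
  {for x, continuous (chord_curv f f1 c r)}.
Proof.
move=> xI.
have aI : lo < c - r < hi by have := r0; have := loc; have := chi; lra.
have bI : lo < c + r < hi by have := r0; have := loc; have := chi; lra.
by apply: cvgMr_tmp; apply: cvgB; exact: slope_continuous.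
Qed.

Lemma chord_curvE x : f x - chord f c r x = (x - (c - r)) * (c + r - x) * chord_curv f f1 c r x.
Proof.
rewrite /chord_curv /slope /chord.
have rr : r != 0 by rewrite lt0r_neq0.
have [->|xa] := eqVneq x (c - r); first by rewrite !subrr !mul0r mulr0 addr0 subrr.
have [->|xb] := eqVneq x (c + r).
  by rewrite subrr mulr0 !mul0r; field.
by field; rewrite rr !subr_eq0 xa xb.
Qed.

Let taylor_ge m x y : (forall z, lo < z < hi -> f2 z <= - m) -> lo < x < hi -> lo < y < hi ->
  f y <= f x + f1 x * (y - x) - m / 2 * (y - x) ^+ 2.
Proof.
by move=> hm xI yI; have := taylor2_le df df1 hm xI yI; rewrite mulNr mulNr.
Qed.

(** Averaging the Taylor bounds from x to the two endpoints with weights c + r - x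
    and x - (c - r) cancels the first-order terms. *)
Lemma chord_curv_ge m x : (forall z, lo < z < hi -> f2 z <= - m) ->
  c - r <= x <= c + r -> m / 2 <= chord_curv f f1 c r x.
Proof.
move=> hm xI.
have xI' : lo < x < hi by have := r0; have := loc; have := chi; lra.
have aI : lo < c - r < hi by have := r0; have := loc; have := chi; lra.
have bI : lo < c + r < hi by have := r0; have := loc; have := chi; lra.
have tab := taylor_ge hm aI bI; have tba := taylor_ge hm bI aI.
have txa := taylor_ge hm xI' aI; have txb := taylor_ge hm xI' bI.
rewrite /chord_curv ler_pdivlMr ?mulr_gt0 // /slope.
have ab : c - r != c + r by apply/eqP; have := r0; lra.
have [e|xa] := eqVneq x (c - r).
  rewrite e (negbTE ab).
  have -> : (f (c - r) - f (c + r)) / (c - r - (c + r)) = (f (c + r) - f (c - r)) / (2 * r).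
    have -> : c - r - (c + r) = - (2 * r) by ring.
    by rewrite invrN mulrN -mulNr opprB.
  rewrite lerBrDr -lerBrDl ler_pdivrMr ?mulr_gt0 //.
  move: tab; have -> : c + r - (c - r) = 2 * r by ring.
  by lra.
have [e|xb] := eqVneq x (c + r).
  rewrite e.
  have -> : c + r - (c - r) = 2 * r by ring.
  rewrite lerBrDr ler_pdivlMr ?mulr_gt0 //.
  move: tba; have -> : c - r - (c + r) = - (2 * r) by ring.
  by rewrite sqrrN; lra.
have xa0 : 0 < x - (c - r) by rewrite subr_gt0 lt_neqAle eq_sym xa; case/andP: xI.
have xb0 : 0 < c + r - x by rewrite subr_gt0 lt_neqAle xb; case/andP: xI.
rewrite -(ler_pM2r (mulr_gt0 xa0 xb0)).
have -> : ((f x - f (c - r)) / (x - (c - r)) - (f x - f (c + r)) / (x - (c + r))) *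
   ((x - (c - r)) * (c + r - x)) =
   (f x - f (c - r)) * (c + r - x) + (f x - f (c + r)) * (x - (c - r)).
  by field; rewrite !subr_eq0 xa xb.
by nra.
Qed.

End FixedChord.

End ChordCurvature.

Section HalfPeriod.
Context {R : realType}.
Implicit Types (f : R -> R) (a b c r x y z m M t lo hi : R).
Notation mu := (@lebesgue_measure R).

Definition arc c r t : R := c - r * cos t.

(** Up to the factor lambda/sqrt eps, the time ds spent per unit of the angle t
    along the orbit. *)
Definition time_density f f1 c r t : R :=
  (Num.sqrt (2 * chord_curv f f1 c r (arc c r t)))^-1.

(** Equal to lambda/sqrt eps times the mean of the orbit, once lambda is chosen so
    that half a period lasts one unit of time. *)
Definition half_period_moment f f1 c r : R :=
  \int[mu]_(t in `[0, pi]) (arc c r t * time_density f f1 c r t).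

Lemma arc_range c r t : 0 < r -> c - r <= arc c r t <= c + r.
Proof.
move=> r0; have := cos_geN1 t; have := cos_le1 t; rewrite /arc => h1 h2.
by apply/andP; split; nra.
Qed.

Lemma arc_continuous c r : continuous (arc c r).
Proof.
move=> t; apply: cvgB; first exact: cvg_cst.
by apply: cvgMl_tmp; exact: continuous_cos.
Qed.

Lemma chord_curv_opp f f1 c r x :
  chord_curv (fun z => - f z) (fun z => - f1 z) c r x = - chord_curv f f1 c r x.
Proof.
have sl a : slope (fun z => - f z) (fun z => - f1 z) a x = - slope f f1 a x.
  by rewrite /slope; case: ifP => // _; rewrite -opprD mulNr.
by rewrite /chord_curv !sl -mulNr opprD.
Qed.

Section BoundedCurvature.
Variables (f f1 f2 : R -> R) (lo hi : R).
Hypothesis df : forall z : R, lo < z < hi -> is_derive z 1 f (f1 z).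
Hypothesis df1 : forall z : R, lo < z < hi -> is_derive z 1 f1 (f2 z).

Lemma chord_curv_le c r M x : 0 < r -> lo < c - r -> c + r < hi ->
  (forall z, lo < z < hi -> - M <= f2 z) ->
  c - r <= x <= c + r -> chord_curv f f1 c r x <= M / 2.
Proof.
move=> r0 loc chi hM xI.
have d z : lo < z < hi -> is_derive z 1 (fun z => - f z) (- f1 z).
  by move=> /df h; apply: is_deriveN.
have d1 z : lo < z < hi -> is_derive z 1 (fun z => - f1 z) (- f2 z).
  by move=> /df1 h; apply: is_deriveN.
have hm z : lo < z < hi -> - f2 z <= - (- M) by move=> /hM; rewrite lerN2.
have := chord_curv_ge d d1 r0 loc chi hm xI.
by rewrite chord_curv_opp mulNr lerN2.
Qed.

Variables (m M : R).
Hypothesis m0 : 0 < m.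
Hypothesis f2m : forall z, lo < z < hi -> f2 z <= - m.
Hypothesis f2M : forall z, lo < z < hi -> - M <= f2 z.

Lemma chord_curv_bounds c r t : 0 < r -> lo < c - r -> c + r < hi ->
  m <= 2 * chord_curv f f1 c r (arc c r t) <= M.
Proof.
move=> r0 loc chi; have aI := arc_range c t r0.
have := chord_curv_ge df df1 r0 loc chi f2m aI.
have := chord_curv_le r0 loc chi f2M aI.
set k := chord_curv _ _ _ _ _; lra.
Qed.

Lemma time_density_bounds c r t : 0 < r -> lo < c - r -> c + r < hi ->
  (Num.sqrt M)^-1 <= time_density f f1 c r t <= (Num.sqrt m)^-1.
Proof.
move=> r0 loc chi; have /andP[km kM] := chord_curv_bounds t r0 loc chi.
rewrite /time_density; move: (2 * _) km kM => k km kM.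
have k0 := lt_le_trans m0 km; have M0 := lt_le_trans k0 kM.
by rewrite !lef_pV2 ?posrE ?sqrtr_gt0 // !ler_wsqrtr.
Qed.

Lemma time_density_gt0 c r t : 0 < r -> lo < c - r -> c + r < hi ->
  0 < time_density f f1 c r t.
Proof.
move=> r0 loc chi; have /andP[km _] := chord_curv_bounds t r0 loc chi.
by rewrite invr_gt0 sqrtr_gt0 (lt_le_trans m0).
Qed.

Lemma time_density_continuous c r : 0 < r -> lo < c - r -> c + r < hi ->
  continuous (time_density f f1 c r).
Proof.
move=> r0 loc chi t; have /andP[km _] := chord_curv_bounds t r0 loc chi.
apply: cvgV; first by rewrite sqrtr_eq0 -ltNge (lt_le_trans m0).
apply: (@cvg_comp _ _ _ (fun t => 2 * chord_curv f f1 c r (arc c r t)) Num.sqrt); last first.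
  exact: sqrt_continuous.
apply: cvgMl_tmp; apply: (@cvg_comp _ _ _ (arc c r) (chord_curv f f1 c r)).
  exact: arc_continuous.
apply: (chord_curv_continuous df df1 r0 loc chi).
by have := arc_range c t r0; lra.
Qed.

Lemma moment_integrand_continuous c r : 0 < r -> lo < c - r -> c + r < hi ->
  continuous (fun t => arc c r t * time_density f f1 c r t).
Proof.
move=> r0 loc chi t; apply: cvgM; first exact: arc_continuous.
exact: time_density_continuous.
Qed.

Lemma int_arc c r : \int[mu]_(t in `[0, pi]) arc c r t = pi * c.
Proof.
have d t : is_derive t 1 (fun t => c * t - r * sin t) (arc c r t).
  by apply: is_derive_eq; rewrite /GRing.scale /= /arc; ring.
rewrite (FTC2 d (@arc_continuous c r) (pi_ge0 R)).
by rewrite sinpi sin0; ring.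
Qed.

Lemma half_period_moment_bounds c r : 0 <= lo -> 0 < r -> lo < c - r -> c + r < hi ->
  pi * c / Num.sqrt M <= half_period_moment f f1 c r <= pi * c / Num.sqrt m.
Proof.
move=> lo0 r0 loc chi.
have ci := continuous_integrable_cc 0 pi (moment_integrand_continuous r0 loc chi).
have ca := continuous_integrable_cc 0 pi (@arc_continuous c r).
have caZ k : mu.-integrable `[0, pi] (EFin \o (fun t => arc c r t * k)).
  apply: continuous_integrable_cc => t; apply: cvgMr_tmp; exact: arc_continuous.
have a0 t : 0 <= arc c r t by have := arc_range c t r0; lra.
rewrite -(int_arc c r) -!RintegralZr //; apply/andP; split; apply: le_Rintegral => // t _.
  by rewrite ler_wpM2l //; case/andP: (time_density_bounds t r0 loc chi).
by rewrite ler_wpM2l //; case/andP: (time_density_bounds t r0 loc chi).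
Qed.

(** Away from the turning points the divided difference is the quotient of
    f minus its chord by r^2 sin^2 t, whose dependence on c is plainly continuous. *)
Lemma moment_integrand_continuous_center r t u v : 0 < r -> 0 < t < pi ->
  lo < u - r -> v + r < hi ->
  forall c, u < c < v -> {for c, continuous (fun c => arc c r t * time_density f f1 c r t)}.
Proof.
move=> r0 tI lou vhi c cI.
have st0 : 0 < sin t by exact: sin_gt0_pi.
have rn : r != 0 by rewrite lt0r_neq0.
(* no base point of a difference quotient meets the argument, since sin t > 0 *)
pose K c := (f (arc c r t) - chord f c r (arc c r t)) / (r * sin t) ^+ 2.
have KE c' : chord_curv f f1 c' r (arc c' r t) = K c'.
  rewrite /K (chord_curvE f f1 _ r0) /arc.
  have -> : (c' - r * cos t - (c' - r)) * (c' + r - (c' - r * cos t)) =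
            (r * sin t) ^+ 2.
    have := cos2Dsin2 t; set k := cos t; set s := sin t => ks.
    have -> : (r * s) ^+ 2 = r ^+ 2 * ((k ^+ 2 + s ^+ 2) - k ^+ 2) by ring.
    by rewrite ks; ring.
  by rewrite mulrAC divff ?mul1r // expf_neq0 // mulf_neq0 // lt0r_neq0.
have cf c' x : lo < c' + x < hi -> (fun c => f (c + x)) @ c' --> f (c' + x).
  move=> xI; have cfx := is_derive_continuous (df xI).
  apply: (@cvg_comp _ _ _ (fun c => c + x) f _ (nbhs (c' + x))); last exact: cfx.
  by apply: cvgD; [exact: cvg_id|exact: cvg_cst].
have carc : (fun c => arc c r t) @ c --> arc c r t.
  by apply: cvgB; [exact: cvg_id|exact: cvg_cst].
have aI := arc_range c t r0.
have km := chord_curv_bounds t r0 (ltac:(lra) : lo < c - r) (ltac:(lra) : c + r < hi).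
apply: cvgM; first exact: carc.
apply: cvgV; first by rewrite sqrtr_eq0 -ltNge (lt_le_trans m0) //; case/andP: km.
apply: (@cvg_comp _ _ _ (fun c => 2 * chord_curv f f1 c r (arc c r t)) Num.sqrt); last first.
  exact: sqrt_continuous.
apply: cvgMl_tmp; rewrite (_ : (fun c => chord_curv f f1 c r (arc c r t)) = K); last first.
  by apply/funext => c'; exact: KE.
rewrite KE; apply: cvgMr_tmp; apply: cvgB.
  have aI2 : lo < arc c r t < hi by lra.
  have cfa := is_derive_continuous (df aI2).
  by apply: (@cvg_comp _ _ _ (fun c => arc c r t) f _ (nbhs (arc c r t))); [exact: carc|exact: cfa].
have ca : f (x - r) @[x --> c] --> f (c - r) by apply: cf; lra.
have cb : f (x + r) @[x --> c] --> f (c + r) by apply: cf; lra.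
apply: cvgD; first exact: ca.
apply: cvgM; first by apply: cvgMr_tmp; apply: cvgB; [exact: cb|exact: ca].
apply: cvgB; first exact: carc.
by apply: cvgB; [exact: cvg_id|exact: cvg_cst].
Qed.

Lemma half_period_moment_continuous r u v : 0 <= lo -> 0 < r ->
  lo < u - r -> v + r < hi ->
  forall c, u < c < v -> {for c, continuous (fun c => half_period_moment f f1 c r)}.
Proof.
move=> lo0 r0 lou vhi c cI.
pose F c t := arc c r t * time_density f f1 c r t.
have cF c' : u < c' < v -> continuous (F c').
  by move=> c'I; apply: moment_integrand_continuous => //; lra.
have Foo c' : u < c' < v ->
    \int[mu]_(t in `]0, pi[) F c' t = half_period_moment f f1 c' r.
  move=> c'I; rewrite /half_period_moment /Rintegral [in RHS]integral_itv_bndoo //.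
  apply/measurable_EFinP; exact: (measurable_continuous (cF _ c'I)).
have oo q : continuous q -> mu.-integrable `]0, pi[ (EFin \o q).
  move=> cq; apply: integrableS (continuous_integrable_cc 0 pi cq) => //.
  exact: subset_itv_oo_cc.
have mB : measurable (`]0, pi[%classic : set (measurableTypeR R)) by exact: measurable_itv.
have h1 x : `]u, v[%classic x -> mu.-integrable `]0, pi[ (EFin \o F x).
  by rewrite /= in_itv /= => xI; exact: oo (cF _ xI).
have h2 : {ae mu, forall y, `]0, pi[%classic y -> {in `]u, v[%classic, continuous (F ^~ y)}}.
  apply: aeW => y; rewrite /= in_itv /= => yI x; rewrite inE /= in_itv /= => xI.
  exact: (moment_integrand_continuous_center r0 yI lou vhi xI).
have h3 : mu.-integrable `]0, pi[ (EFin \o (fun=> hi / Num.sqrt m)).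
  by apply: oo; exact: cst_continuous.
have h4 x : `]u, v[%classic x -> {ae mu, forall y, `]0, pi[%classic y -> `|F x y| <= hi / Num.sqrt m}.
  rewrite /= in_itv /= => xI; apply: aeW => y _.
  have aI := arc_range x y r0.
  have lx : lo < x - r by lra.
  have hx : x + r < hi by lra.
  have /andP[_ tm] := time_density_bounds y r0 lx hx.
  have t0 := time_density_gt0 y r0 lx hx.
  rewrite normrM (gtr0_norm t0) ger0_norm; last lra.
  by apply: ler_pM => //; [lra|exact: ltW|lra].
have cI' : c \in `]u, v[%classic by rewrite inE /= in_itv.
have ct := continuity_under_integral mB h1 h2 h3 h4 cI'.
apply: (near_eq_continuous (g := fun c => \int[mu]_(t in `]0, pi[) F c t)); last exact: ct.
by apply: filterS (near_in_itv cI) => y yI; exact: Foo.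
Qed.

End BoundedCurvature.
End HalfPeriod.

Section Inverse.
Context {R : realType}.

(** A derivative bounded below by k > 0 makes G grow at least linearly in both
    directions, hence onto. *)
Lemma global_inverse (G g : R -> R) (k : R) : 0 < k ->
  (forall x : R, is_derive x 1 G (g x)) -> (forall x, k <= g x) ->
  exists th : R -> R, [/\ cancel th G, cancel G th, {homo th : x y / x < y} &
    forall y : R, is_derive y 1 th (g (th y))^-1].
Proof.
move=> k0 dG kg.
have cG : continuous G by move=> x; exact: is_derive_continuous (dG x).
have grow x y : x <= y -> k * (y - x) <= G y - G x.
  move=> xy; have [c _ ->] := @MVT_segment _ G g x y xy (fun t _ => dG t)
    (@is_derive_within R g G x y (fun t _ => dG t)).
  by rewrite ler_wpM2r ?subr_ge0.
have mono x y : x < y -> G x < G y.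
  move=> xy; have := grow _ _ (ltW xy).
  have kxy : 0 < k * (y - x) by rewrite mulr_gt0 ?subr_gt0.
  by lra.
have inj : injective G.
  by move=> x y e; have [/mono|/mono|//] := ltgtP x y; rewrite e ltxx.
have surj y : exists x, G x = y.
  pose d := `|y - G 0| / k.
  have d0 : 0 <= d by rewrite divr_ge0 // ltW.
  have kd : k * d = `|y - G 0| by rewrite /d mulrC divfK // lt0r_neq0.
  have h1 := grow 0 d d0.
  have h2 := grow (- d) 0 (ltac:(lra)).
  rewrite subr0 kd in h1; rewrite sub0r opprK kd in h2.
  have a1 := ler_norm (y - G 0); have a2 := ler_norm (- (y - G 0)); rewrite normrN in a2.
  have [||c _ e] := @IVT R G (- d) d y _ (continuous_within cG); try lra.
    by rewrite ge_min le_max; apply/andP; split; apply/orP; [left|right]; lra.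
  by exists c.
have [th thE] := choice surj.
have Gth : cancel G th by move=> x; apply: inj; rewrite thE.
exists th; split => //.
  move=> x y xy; rewrite ltNge; apply/negP; rewrite le_eqVlt => /orP[/eqP e|/mono].
    by move: xy; rewrite -(thE x) -(thE y) e ltxx.
  by rewrite !thE ltNge (ltW xy).
move=> y; have gn : g (th y) != 0 by rewrite gt_eqF // (lt_le_trans k0).
have n1 : {near th y, cancel G th} by near=> x; exact: Gth.
have n2 : {near th y, continuous G} by near=> x; exact: cG.
by have := is_derive_inverse n1 n2 (dG (th y)) gn; rewrite thE.
Unshelve. all: by end_near. Qed.

End Inverse.

Section Quadrature.
Context {R : realType}.
Variables (W : R -> R) (gam kap eps : R).
Hypothesis hW : stored_energy W gam kap.
Hypothesis heps : 0 < eps.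
Implicit Types (f g u v w F G : R -> R) (x y z s t l : R).
Notation V := (Wstarr W).
Notation V1 := ((Wstarr W)^`()%classic).
Notation V2 := ((Wstarr W)^`(2)%classic).

Variables (lo hi m M c r : R).
Hypothesis (lo0 : 0 <= lo) (m0 : 0 < m) (r0 : 0 < r) (loc : lo < c - r) (chi : c + r < hi).
Hypothesis V2m : forall z, lo < z < hi -> V2 z <= - m.
Hypothesis V2M : forall z, lo < z < hi -> - M <= V2 z.

Let dV z : lo < z < hi -> is_derive z 1 V (V1 z).
Proof. by case/andP => lz _; apply: (V_derive hW); exact: le_lt_trans lz. Qed.

Let dV1 z : lo < z < hi -> is_derive z 1 V1 (V2 z).
Proof. by case/andP => lz _; apply: (V1_derive hW); exact: le_lt_trans lz. Qed.

Local Notation om := (time_density V V1 c r).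
Local Notation curv := (chord_curv V V1 c r).
Local Notation H_ := (arc c r).
Let sig := (V (c + r) - V (c - r)) / (2 * r).

Let comega : continuous om := time_density_continuous dV dV1 m0 V2m V2M r0 loc chi.

Let om_gt0 t : 0 < om t := time_density_gt0 dV dV1 m0 V2m V2M t r0 loc chi.

Let M0 : 0 < M.
Proof.
have /andP[h1 h2] := chord_curv_bounds dV dV1 V2m V2M 0 r0 loc chi.
exact: lt_le_trans (lt_le_trans m0 h1) h2.
Qed.

Let arcI t : lo < H_ t < hi.
Proof. by have := arc_range c t r0; have := loc; have := chi; lra. Qed.

Let arc_gt0 t : 0 < H_ t.
Proof. by have /andP[h _] := arcI t; exact: le_lt_trans h. Qed.

(** The angle th as a function of time, normalised to cross from 0 to pi in unit
    time.  The last clause is the change of variables t = th y, obtained by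
    differentiating a primitive along th. *)
Lemma half_period_exists : exists (T : R) (th : R -> R), [/\ 0 < T, th 0 = 0, th 1 = pi,
  {homo th : x y / x < y} & (forall y : R, is_derive y 1 th (T / om (th y))) /\
  forall F g : R -> R, (forall t : R, is_derive t 1 F (g t)) -> continuous g ->
    int01 (fun y => g (th y) / om (th y)) * T = F pi - F 0].
Proof.
have [G dG] := continuous_primitive comega.
have pi0 := pi_gt0 R.
have T0 : 0 < G pi - G 0.
  have [z _ ->] := @MVT R G om 0 pi pi0 (fun t _ => dG t)
    (@is_derive_within R om G 0 pi (fun t _ => dG t)).
  by rewrite mulr_gt0 // subr0.
set T := G pi - G 0 in T0 *.
pose S t := T^-1 * (G t - G 0).
have dS t : is_derive t 1 S (T^-1 * om t).
  by have := dG t => h; apply: is_derive_eq; rewrite /GRing.scale /= subr0.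
have k0 : 0 < T^-1 * (Num.sqrt M)^-1 by rewrite mulr_gt0 ?invr_gt0 ?sqrtr_gt0.
have kS t : T^-1 * (Num.sqrt M)^-1 <= T^-1 * om t.
  rewrite ler_wpM2l ?invr_ge0 ?(ltW T0) //.
  by case/andP: (time_density_bounds dV dV1 m0 V2m V2M t r0 loc chi).
have [th [thS Sth thmono dth]] := global_inverse k0 dS kS.
have th0 : th 0 = 0 by rewrite -[X in th X](_ : S 0 = 0) // /S subrr mulr0.
have th1 : th 1 = pi by rewrite -[X in th X](_ : S pi = 1) // /S mulVf // lt0r_neq0.
have Tn := lt0r_neq0 T0.
have dth' y : is_derive y 1 th (T / om (th y)).
  by rewrite -[T]invrK -invfM; exact: dth.
have cth : continuous th by move=> y; exact: is_derive_continuous (dth' y).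
exists T, th; split => //; split => // F g dF cg.
have dK y : is_derive y 1 (fun y => T^-1 * F (th y)) (g (th y) / om (th y)).
  have hd := @is_derive1_comp R F th y _ _ (dF (th y)) (dth' y).
  have hd2 := @is_deriveZ R R R (F \o th) T^-1 y 1 _ hd.
  suff -> : g (th y) / om (th y) = T^-1 *: (g (th y) * (T / om (th y))) by exact: hd2.
  by rewrite /GRing.scale /= [g (th y) * (T * _)]mulrCA mulKf.
have cK : continuous (fun y => g (th y) / om (th y)).
  move=> y; apply: cvgM.
    by apply: (@cvg_comp _ _ _ th g _ (nbhs (th y))); [exact: cth|exact: cg].
  apply: cvgV; first exact: lt0r_neq0.
  by apply: (@cvg_comp _ _ _ th om _ (nbhs (th y))); [exact: cth|exact: comega].
rewrite (FTC01 dK cK) th0 th1 -mulrBr mulrAC mulVf ?mul1r //.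
Qed.

(** On ]0, 1[ the derivative g of u equals l T sqrt (2 (V - L)) at H, which
    differentiates to the equation eps u'' = l^3 (V1 (H) - sig).  At the two turning
    points the square root is not differentiable, so g is identified on [0, 1]
    with a primitive P of the right-hand side; integration by parts against
    v - u then reduces the variational integral to sig times the mean of v - u,
    which is 0. *)
Lemma quadrature_equilibrium : half_period_moment V V1 c r = (Num.sqrt eps)^-1 ->
  exists (l : R) (u : R -> R), [/\ 0 < l, c - r <= l^-1 <= c + r, equilibrium eps W l u,
    HH_norm u <= l ^+ 2 / Num.sqrt eps * (r * Num.sqrt M) &
    exists2 s : R, s \in `[0, 1] & u s != 0].
Proof.
move=> Phi; have [T [th [T0 th0 th1 thmono [dth subst]]]] := half_period_exists.
have cth : continuous th by move=> y; exact: is_derive_continuous (dth y).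
have se0 : 0 < Num.sqrt eps by rewrite sqrtr_gt0.
have omn t : om t != 0 by exact: lt0r_neq0.
pose l := Num.sqrt eps * T.
have l0 : 0 < l by rewrite mulr_gt0.
have l2 : l ^+ 2 = eps * T ^+ 2 by rewrite /l exprMn sqr_sqrtr // ltW.
have Tl : T = l / Num.sqrt eps by rewrite /l mulrC mulKf // lt0r_neq0.
clearbody l.
pose H y := H_ (th y).
pose H' y := T * (r * sin (th y) / om (th y)).
have dH y : is_derive y 1 H (H' y).
  have darc : is_derive (th y) 1 (arc c r) (r * sin (th y)).
    by rewrite /arc; apply: is_derive_eq; rewrite /GRing.scale /=; ring.
  have hd := @is_derive1_comp R (arc c r) th y _ _ darc (dth y).
  suff -> : H' y = r * sin (th y) * (T / om (th y)) by exact: hd.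
  by rewrite /H' mulrCA mulrA.
have cH : continuous H by move=> y; exact: is_derive_continuous (dH y).
have csth : continuous (fun y => sin (th y)).
  by move=> y; apply: (@cvg_comp _ _ _ th sin _ (nbhs (th y))); [exact: cth|exact: continuous_sin].
have comth : continuous (fun y => om (th y)).
  by move=> y; apply: (@cvg_comp _ _ _ th om _ (nbhs (th y))); [exact: cth|exact: comega].
have cH' : continuous H'.
  move=> y; apply: cvgMl_tmp; apply: cvgM; first by apply: cvgMl_tmp; exact: csth.
  by apply: cvgV; [exact: omn|exact: comth].
pose u y := l * H y - 1.
pose g y := l * H' y.
have du y : is_derive y 1 u (g y).
  by have := dH y => hd; apply: is_derive_eq; rewrite /GRing.scale /= subr0.
have cu : continuous u by move=> y; exact: is_derive_continuous (du y).
have cg : continuous g by move=> y; apply: cvgMl_tmp; exact: cH'.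
have wu : weak_derivative u g := C1_weak_derivative du cg.
have cuw : {within `[0, 1], continuous u} := continuous_within cu.
have ulE s : (1 + u s) / l = H s.
  by rewrite /u addrC subrK mulrC mulKf // lt0r_neq0.
have up s : 0 < 1 + u s by rewrite /u addrC subrK mulr_gt0 // /H.
have intH : int01 H = l^-1.
  have cmi := moment_integrand_continuous dV dV1 m0 V2m V2M r0 loc chi.
  have [N dN] := continuous_primitive cmi.
  have := subst _ _ dN cmi.
  rewrite -(FTC2 dN cmi (pi_ge0 R)) -/(half_period_moment V V1 c r) Phi.
  rewrite (@int01_eq R _ H); last by move=> s _; rewrite mulfK.
  rewrite Tl => e; apply: (mulIf (lt0r_neq0 l0)); rewrite mulVf ?lt0r_neq0 //.
  apply: (mulIf (invr_neq0 (lt0r_neq0 se0))).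
  by rewrite mul1r -mulrA; exact: e.
have iH := continuous_itg01 cH.
have int_u : int01 u = 0.
  by rewrite (int01B (itg01Z _ iH) (itg01_cst 1)) (int01Z _ iH) intH int01_cst mulfV ?subrr // lt0r_neq0.
have Ku : KK u.
  split; first exact: HH_intro cuw wu int_u.
  by move=> s _; have := up s; lra.
(* inside the interval g is a multiple of the square root of V minus its chord *)
have dg_interior y : 0 < y < 1 -> is_derive y 1 g (l * T ^+ 2 * (V1 (H y) - sig)).
  move=> yI.
  have sin_pos x : 0 < x < 1 -> 0 < sin (th x).
    move=> /andP[x0 x1]; apply: sin_gt0_pi.
    by rewrite -th0 -th1 !thmono.
  pose P x := V x - chord V c r x.
  have PE x : P (H x) = (r * sin (th x)) ^+ 2 * curv (H x).
    rewrite /P (chord_curvE V V1 _ r0) /H /arc; congr (_ * _).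
    have := cos2Dsin2 (th x); set k := cos _; set s := sin _ => ks.
    have -> : (r * s) ^+ 2 = r ^+ 2 * ((k ^+ 2 + s ^+ 2) - k ^+ 2) by ring.
    by rewrite ks; ring.
  have k0 x : 0 < 2 * curv (H x).
    have /andP[h _] := chord_curv_bounds dV dV1 V2m V2M (th x) r0 loc chi.
    exact: lt_le_trans h.
  have P0 x : 0 < x < 1 -> 0 < 2 * P (H x).
    by move=> /sin_pos sx; rewrite PE mulrCA mulr_gt0 // exprn_gt0 // mulr_gt0.
  have H'E x : 0 < x < 1 -> H' x = T * Num.sqrt (2 * P (H x)).
    move=> xI; have rs : 0 < r * sin (th x) by rewrite mulr_gt0 // sin_pos.
    rewrite PE mulrCA sqrtrM ?sqr_ge0 // sqrtr_sqr (gtr0_norm rs).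
    by rewrite /H' /time_density invrK.
  have gE x : 0 < x < 1 -> g x = l * T * Num.sqrt (2 * P (H x)).
    by move=> xI; rewrite /g H'E // mulrA.
  have dP x : lo < x < hi -> is_derive x 1 (fun x => 2 * P x) (2 * (V1 x - sig)).
    move=> /dV d; rewrite /P /chord.
    apply: is_derive_eq; rewrite /GRing.scale /= -/sig; ring.
  have d1 := @is_derive1_comp R (fun x => 2 * P x) H y _ _ (dP _ (arcI (th y))) (dH y).
  have d2 := @is_derive1_comp R Num.sqrt _ y _ _ (is_derive1_sqrt (P0 y yI)) d1.
  have d3 := @is_deriveZ R R R _ (l * T) y 1 _ d2.
  have -> : l * T ^+ 2 * (V1 (H y) - sig) = l * T *:
     ((2 * Num.sqrt (2 * P (H y)))^-1 * (2 * (V1 (H y) - sig) * H' y)).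
    rewrite H'E // /GRing.scale /=; field.
    by rewrite lt0r_neq0 // sqrtr_gt0 P0.
  apply: near_eq_is_derive d3.
  by apply: filterS (near_in_itv yI) => x xI; rewrite gE.
exists l, u; split => //.
- rewrite -intH -[c - r](int01_cst) -[c + r](int01_cst); apply/andP; split.
    by apply: int01_le => //; [exact: itg01_cst|move=> s _; case/andP: (arc_range c (th s) r0)].
  by apply: int01_le => //; [exact: itg01_cst|move=> s _; case/andP: (arc_range c (th s) r0)].
- split => // v /KK_facts [cv wv v0 _].
  have wvu := weak_derivative_sub cuw cv wu wv.
  have cvu : {within `[0, 1], continuous (v \- u)} := within_sub cuw cv.
  have [|i1 i2 ->] := variational_integralE eps hW l0 cuw cv wu wvu; first by move=> s _.
  pose q y := l * T ^+ 2 * (V1 (H y) - sig).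
  have cV1H : continuous (fun y => V1 (H y)).
    move=> y; have cf := V1_continuous hW (arc_gt0 (th y)).
    by apply: (@cvg_comp _ _ _ H V1 _ (nbhs (H y))); [exact: cH|exact: cf].
  have cq : continuous q.
    by move=> y; apply: cvgMl_tmp; apply: cvgB; [exact: cV1H|exact: cvg_cst].
  have dg y : 0 < y < 1 -> is_derive y 1 g (q y) by exact: dg_interior.
  have [P0 dP0] := continuous_primitive cq.
  pose P y := P0 y - P0 0.
  have dP y : is_derive y 1 P (q y).
    by have := dP0 y => hd; apply: is_derive_eq; rewrite subr0.
  have cP : continuous P by move=> y; exact: is_derive_continuous (dP y).
  have g0 : g 0 = 0 by rewrite /g /H' th0 sin0 mulr0 mul0r !mulr0.
  have g1 : g 1 = 0 by rewrite /g /H' th1 sinpi mulr0 mul0r !mulr0.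
  have P00 : P 0 = 0 by rewrite /P subrr.
  (* both vanish at 0 and have the same derivative inside *)
  have gP y : 0 <= y <= 1 -> g y = P y.
    case/andP => y0 y1.
    have cgP : continuous (fun y => g y - P y) by move=> x; apply: cvgB; [exact: cg|exact: cP].
    have dgP x : x \in `]0, y[%R -> is_derive x 1 (fun y => g y - P y) ((fun=> 0) x).
      rewrite in_itv /= => xI; have h1 := dP x; have h2 := dg x ltac:(lra).
      by apply: is_derive_eq; rewrite subrr.
    have [z _] := MVT_segment y0 dgP (continuous_within cgP).
    by rewrite mul0r g0 P00 !subr0 => /eqP; rewrite subr_eq0 => /eqP.
  have P10 : P 1 = 0 by rewrite -gP // ler01 lexx.
  have ibp := weak_derivative_by_parts cvu wvu dP cq P00 P10.
  have svu := within_sqi cvu.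
  have ivu := sqi_itg svu.
  have int_vu : int01 (v \- u) = 0.
    by rewrite (int01B (sqi_itg (within_sqi cv)) (sqi_itg (within_sqi cuw))) v0 int_u subrr.
  have iV1 : itg01 (fun s => V1 (H s) * (v s - u s)).
    by apply: sqi_mul svu; exact: continuous_sqi.
  have -> : int01 (fun s => V1 ((1 + u s) / l) * (v s - u s)) =
            int01 (fun s => V1 (H s) * (v s - u s)).
    by apply: int01_eq => s _; rewrite ulE.
  have -> : int01 (fun s => g s * (wderiv v s - g s)) =
            - int01 (fun s => (v \- u) s * q s).
    rewrite ibp opprK; apply: int01_eq => s /andP[s0 s1].
    have sI : 0 <= s <= 1 by rewrite !ltW.
    by rewrite -(gP s sI) mulrC.
  have -> : int01 (fun s => (v \- u) s * q s) =
            l * T ^+ 2 * int01 (fun s => V1 (H s) * (v s - u s)).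
    rewrite (@int01_eq R _ (fun s => l * T ^+ 2 * (V1 (H s) * (v s - u s)) -
        l * T ^+ 2 * sig * (v \- u) s)); last by move=> s _ /=; rewrite /q; ring.
    by rewrite (int01B (itg01Z _ iV1) (itg01Z _ ivu)) !int01Z // int_vu mulr0 subr0.
  set I := int01 _.
  have -> : l ^+ 3 = eps * (l * T ^+ 2) by rewrite mulrCA -l2 -exprS.
  by rewrite mulrN mulrA addNr.
- rewrite (HH_normE wu).
  set B := _ / _ * _.
  have B0 : 0 <= B.
    by rewrite /B mulr_ge0 ?divr_ge0 ?sqr_ge0 ?(ltW se0) ?mulr_ge0 ?sqrtr_ge0 ?(ltW r0).
  rewrite -[leRHS](ger0_norm B0) -[leRHS]sqrtr_sqr ler_wsqrtr //.
  rewrite -[leRHS]int01_cst; apply: int01_le; [|exact: itg01_cst|].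
    exact: continuous_itg01 (continuous_sqr cg).
  move=> s _; rewrite -(real_normK (num_real (g s))) ler_sqr ?nnegrE //.
  have s1 : `|sin (th s)| <= 1 by rewrite ler_norml sin_geN1 sin_le1.
  have oM : (om (th s))^-1 <= Num.sqrt M.
    have /andP[bM _] := time_density_bounds dV dV1 m0 V2m V2M (th s) r0 loc chi.
    have Mi : 0 < (Num.sqrt M)^-1 by rewrite invr_gt0 sqrtr_gt0.
    by rewrite -[leRHS]invrK lef_pV2 // posrE ?Mi ?om_gt0.
  have A0 : 0 <= l ^+ 2 / Num.sqrt eps by rewrite divr_ge0 ?sqr_ge0 // ltW.
  have o0 : 0 <= (om (th s))^-1 by rewrite invr_ge0 ltW.
  have -> : g s = l ^+ 2 / Num.sqrt eps * (r * (om (th s))^-1) * sin (th s).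
    by rewrite /g /H' {1}Tl; move: (om (th s))^-1 => k; ring.
  have r0' := ltW r0.
  have C0 := mulr_ge0 A0 (mulr_ge0 r0' o0).
  rewrite normrM (ger0_norm C0) -[leRHS]mulr1 ler_pM //.
  by rewrite /B ler_wpM2l // ler_wpM2l.
- have u01 : u 1 - u 0 = 2 * l * r.
    by rewrite /u /H /arc th0 th1 cos0 cospi; ring.
  have lr : 0 < l * r by rewrite mulr_gt0.
  have [z0|nz0] := eqVneq (u 0) 0; last by exists 0 => //; rewrite inE /= in_itv /= lexx ler01.
  exists 1; first by rewrite inE /= in_itv /= lexx ler01.
  by apply/eqP => z1; move: u01; rewrite z0 z1; lra.
Qed.

End Quadrature.

Section Bifurcation.
Context {R : realType}.
Variables (W : R -> R) (gam kap eps : R).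
Hypothesis hW : stored_energy W gam kap.
Hypothesis heps : 0 < eps.
Implicit Types (f g u v w F G : R -> R) (x y z s t l c r h m M k : R).
Notation V := (Wstarr W).
Notation V1 := ((Wstarr W)^`()%classic).
Notation V2 := ((Wstarr W)^`(2)%classic).
Notation Phi := (half_period_moment V V1).

Lemma V_derive_on lo hi : 0 <= lo -> forall z, lo < z < hi -> is_derive z 1 V (V1 z).
Proof. by move=> lo0 z /andP[lz _]; apply: (V_derive hW); exact: le_lt_trans lz. Qed.

Lemma V1_derive_on lo hi : 0 <= lo -> forall z, lo < z < hi -> is_derive z 1 V1 (V2 z).
Proof. by move=> lo0 z /andP[lz _]; apply: (V1_derive hW); exact: le_lt_trans lz. Qed.

(** Links the limit pi x/sqrt (- V2 x) of the moment for small orbits with the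
    sign of the stiffness. *)
Lemma moment_limit_lt x k : 0 < x -> eps * pi ^+ 2 * x ^+ 2 < k ->
  pi * x / Num.sqrt k < (Num.sqrt eps)^-1.
Proof.
move=> x0 xk; have pi0 := pi_gt0 R.
have k0 : 0 < k by apply: le_lt_trans xk; rewrite !mulr_ge0 ?sqr_ge0 // ltW.
have px : 0 < pi * x by rewrite mulr_gt0.
rewrite ltr_pdivrMr ?sqrtr_gt0 // [ltRHS]mulrC ltr_pdivlMr ?sqrtr_gt0 //.
rewrite -[pi * x]gtr0_norm // -sqrtr_sqr -sqrtrM ?sqr_ge0 // ltr_sqrt //.
by rewrite exprMn [_ * eps]mulrC mulrA.
Qed.

Lemma moment_limit_gt x k : 0 < x -> 0 < k -> k < eps * pi ^+ 2 * x ^+ 2 ->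
  (Num.sqrt eps)^-1 < pi * x / Num.sqrt k.
Proof.
move=> x0 k0 xk; have pi0 := pi_gt0 R.
have px : 0 < pi * x by rewrite mulr_gt0.
rewrite ltr_pdivlMr ?sqrtr_gt0 // [ltLHS]mulrC ltr_pdivrMr ?sqrtr_gt0 //.
rewrite -[pi * x]gtr0_norm // -sqrtr_sqr -sqrtrM ?sqr_ge0 // ltr_sqrt.
  by rewrite exprMn [_ * eps]mulrC mulrA.
by rewrite mulr_gt0 // exprn_gt0.
Qed.

Section AtSimpleZero.
Variables (h0 rho m M : R).
Hypothesis (rho0 : 0 < rho) (rhoh : rho <= h0) (m0 : 0 < m) (M0 : 0 < M).
Hypothesis V2m : forall z, h0 - rho < z < h0 + rho -> V2 z <= - m.
Hypothesis V2M : forall z, h0 - rho < z < h0 + rho -> - M <= V2 z.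

(** Strictness of stiffness c < 0 leaves room for a bound mm with
    eps pi^2 c^2 < mm < - V2 near c, and the moment is at most pi c/sqrt mm. *)
Lemma moment_small_lt c : h0 - rho < c < h0 + rho -> stiffness eps W c < 0 ->
  exists2 r1, 0 < r1 & forall r, 0 < r < r1 -> Phi c r < (Num.sqrt eps)^-1.
Proof.
move=> /andP[cl ch] G0.
have c0 : 0 < c by have := rhoh; lra.
pose mm := (eps * pi ^+ 2 * c ^+ 2 - V2 c) / 2.
have m1 : eps * pi ^+ 2 * c ^+ 2 < mm by move: G0; rewrite /stiffness /mm; lra.
have m2 : V2 c < - mm by move: G0; rewrite /stiffness /mm; lra.
have [r1 r1I hr1] := upper_bound_near (V2_continuous hW c0) c0 m2.
pose r2 := Num.min r1 (Num.min (c - (h0 - rho)) (h0 + rho - c)).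
have [r20 r21 r22 r23] : [/\ 0 < r2, r2 <= r1, r2 <= c - (h0 - rho) & r2 <= h0 + rho - c].
  by rewrite /r2 !lt_min !ge_min !lexx !orbT; case/andP: r1I => -> _; rewrite !subr_gt0 cl ch.
clearbody r2; exists r2 => // r /andP[r0 rr2].
have lo0 : 0 <= c - r2 by have := rhoh; lra.
have e0 : 0 < eps * pi ^+ 2 * c ^+ 2 by rewrite !mulr_gt0 ?exprn_gt0 ?pi_gt0.
have mm0 : 0 < mm := lt_trans e0 m1.
have hm z : c - r2 < z < c + r2 -> V2 z <= - mm by move=> zI; apply: hr1; lra.
have hM z : c - r2 < z < c + r2 -> - M <= V2 z by move=> zI; apply: V2M; lra.
have l1 : c - r2 < c - r by lra.
have l2 : c + r < c + r2 by lra.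
have /andP[_ h] := half_period_moment_bounds (V_derive_on (hi := c + r2) lo0)
  (V1_derive_on (hi := c + r2) lo0) mm0 hm hM lo0 r0 l1 l2.
exact: le_lt_trans h (moment_limit_lt c0 m1).
Qed.

Lemma moment_small_gt c : h0 - rho < c < h0 + rho -> 0 < stiffness eps W c ->
  exists2 r1, 0 < r1 & forall r, 0 < r < r1 -> (Num.sqrt eps)^-1 < Phi c r.
Proof.
move=> /andP[cl ch] G0.
have c0 : 0 < c by have := rhoh; lra.
have Vc : V2 c <= - m by apply: V2m; rewrite cl ch.
pose MM := (eps * pi ^+ 2 * c ^+ 2 - V2 c) / 2.
have m1 : MM < eps * pi ^+ 2 * c ^+ 2 by move: G0; rewrite /stiffness /MM; lra.
have m2 : - MM < V2 c by move: G0; rewrite /stiffness /MM; lra.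
have MM0 : 0 < MM by have := m0; lra.
have [r1 r1I hr1] := lower_bound_near (V2_continuous hW c0) c0 m2.
pose r2 := Num.min r1 (Num.min (c - (h0 - rho)) (h0 + rho - c)).
have [r20 r21 r22 r23] : [/\ 0 < r2, r2 <= r1, r2 <= c - (h0 - rho) & r2 <= h0 + rho - c].
  by rewrite /r2 !lt_min !ge_min !lexx !orbT; case/andP: r1I => -> _; rewrite !subr_gt0 cl ch.
clearbody r2; exists r2 => // r /andP[r0 rr2].
have lo0 : 0 <= c - r2 by have := rhoh; lra.
have hm z : c - r2 < z < c + r2 -> V2 z <= - m by move=> zI; apply: V2m; lra.
have hM z : c - r2 < z < c + r2 -> - MM <= V2 z by move=> zI; apply: hr1; lra.
have l1 : c - r2 < c - r by lra.
have l2 : c + r < c + r2 by lra.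
have /andP[h _] := half_period_moment_bounds (V_derive_on (hi := c + r2) lo0)
  (V1_derive_on (hi := c + r2) lo0) m0 hm hM lo0 r0 l1 l2.
exact: lt_le_trans (moment_limit_gt c0 MM0 m1) h.
Qed.

(** The amplitude r is fixed first, small enough for both centres h0 - eta and
    h0 + eta; the intermediate value theorem is then applied to the centre. *)
Lemma small_orbit_exists eta rmax : 0 < eta -> eta <= rho / 8 -> 0 < rmax ->
  stiffness eps W (h0 - eta) < 0 -> 0 < stiffness eps W (h0 + eta) ->
  exists c r, [/\ h0 - 2 * eta < c < h0 + 2 * eta, 0 < r, r < rmax &
    Phi c r = (Num.sqrt eps)^-1].
Proof.
move=> eta0 etar rmax0.
have I1 : h0 - rho < h0 - eta < h0 + rho by have := rho0; lra.
have I2 : h0 - rho < h0 + eta < h0 + rho by have := rho0; lra.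
have J1 : h0 - 2 * eta < h0 - eta < h0 + 2 * eta by lra.
have J2 : h0 - 2 * eta < h0 + eta < h0 + 2 * eta by lra.
have L1 r : r <= rho / 8 -> h0 - rho < h0 - 2 * eta - r by have := rho0; lra.
have L2 r : r <= rho / 8 -> h0 + 2 * eta + r < h0 + rho by have := rho0; lra.
have half x y : 0 < x -> y <= x / 2 -> y < x by lra.
move=> Gm Gp.
have [r1 r10 hr1] := moment_small_lt I1 Gm.
have [r2 r20 hr2] := moment_small_gt I2 Gp.
pose r := Num.min (Num.min (r1 / 2) (r2 / 2)) (Num.min (rmax / 2) (rho / 8)).
have [r0 rr1 rr2 [rrm rrh]] : [/\ 0 < r, r <= r1 / 2, r <= r2 / 2 & r <= rmax / 2 /\ r <= rho / 8].
  rewrite /r !lt_min !ge_min !lexx !orbT; split => //.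
  by rewrite !divr_gt0.
clearbody r.
have lo0 : 0 <= h0 - rho by rewrite subr_ge0.
have cPhi := half_period_moment_continuous (V_derive_on (hi := h0 + rho) lo0)
  (V1_derive_on (hi := h0 + rho) lo0) m0 V2m V2M lo0 r0 (L1 r rrh) (L2 r rrh).
have cPhi' z : h0 - 2 * eta < z < h0 + 2 * eta ->
    {for z, continuous (fun c => Phi c r - (Num.sqrt eps)^-1)}.
  by move=> zI; apply: cvgB; [exact: cPhi|exact: cvg_cst].
have P1 : Phi (h0 - eta) r - (Num.sqrt eps)^-1 <= 0.
  by rewrite subr_le0 ltW // hr1 // r0 (half r1).
have P2 : 0 <= Phi (h0 + eta) r - (Num.sqrt eps)^-1.
  by rewrite subr_ge0 ltW // hr2 // r0 (half r2).
have [c cI ec] := zero_between cPhi' J1 J2 P1 P2.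
exists c, r; split => //; first exact: half rrm.
by apply/eqP; rewrite -subr_eq0 ec.
Qed.

Lemma small_equilibrium_exists d delta : 0 < d -> 0 < delta ->
  (forall h, 0 < h -> h < h0 -> stiffness eps W h < 0) ->
  (forall h, h0 < h -> 0 < stiffness eps W h) ->
  exists (l : R) (u : R -> R), [/\ 0 < l, `|l^-1 - h0| < delta, equilibrium eps W l u,
    HH_norm u < d & exists2 s : R, s \in `[0, 1] & u s != 0].
Proof.
move=> d0 delta0 Gm Gp.
have h00 : 0 < h0 := lt_le_trans rho0 rhoh.
pose eta := Num.min (rho / 8) (delta / 8).
have [eta0 etar etad] : [/\ 0 < eta, eta <= rho / 8 & eta <= delta / 8].
  by rewrite /eta lt_min !ge_min !lexx !orbT !divr_gt0.
clearbody eta.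
pose C := (2 / h0) ^+ 2 / Num.sqrt eps * Num.sqrt M.
have C0 : 0 <= C := mulr_ge0 (divr_ge0 (sqr_ge0 _) (sqrtr_ge0 _)) (sqrtr_ge0 _).
pose rmax := Num.min (rho / 8) (Num.min (delta / 8) (d / (C + 1))).
have [rm0 rmr rmd rmC] : [/\ 0 < rmax, rmax <= rho / 8, rmax <= delta / 8 & rmax <= d / (C + 1)].
  rewrite /rmax !lt_min !ge_min !lexx !orbT; split => //.
  by rewrite !divr_gt0 // ltr_wpDl.
clearbody rmax.
have hm0 : 0 < h0 - eta by have := rhoh; have := rho0; lra.
have hm1 : h0 - eta < h0 by lra.
have hp1 : h0 < h0 + eta by lra.
have [c [r [cI r0 rm Phic]]] := small_orbit_exists eta0 etar rm0 (Gm _ hm0 hm1) (Gp _ hp1).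
have lo0 : 0 <= h0 - rho by rewrite subr_ge0.
have [l1 l2 cr] : [/\ h0 - rho < c - r, c + r < h0 + rho & h0 / 2 <= c - r].
  by clear Phic; have := rho0; have := rhoh; split; lra.
have [l [u [l0 lI eq nu us]]] := quadrature_equilibrium hW heps lo0 m0 r0 l1 l2 V2m V2M Phic.
exists l, u; split => //.
  clear Phic nu us; move: lI; move: l^-1 => k kI; rewrite ltr_norml; lra.
apply: le_lt_trans nu _.
(* l^-1 is at least c - r, which is at least h0 / 2 *)
have lh : l <= 2 / h0.
  rewrite -[l]invrK -[2 / h0]invrK lef_pV2 ?posrE ?invr_gt0 ?divr_gt0 //.
  by rewrite invf_div; exact: le_trans cr (andP lI).1.
have lhs : l ^+ 2 / Num.sqrt eps * (r * Num.sqrt M) <= C * r.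
  rewrite /C -[in leRHS]mulrA [Num.sqrt M * r]mulrC.
  apply: ler_wpM2r; first by rewrite mulr_ge0 ?sqrtr_ge0 ?(ltW r0).
  apply: ler_wpM2r; first by rewrite invr_ge0 sqrtr_ge0.
  by rewrite ler_sqr ?nnegrE ?(ltW l0) // divr_ge0 // ltW.
apply: le_lt_trans lhs _.
have C1 : 0 < C + 1 by rewrite ltr_wpDl.
move: rmC; rewrite ler_pdivlMr // => rmC.
apply: (lt_le_trans _ rmC); rewrite mulrDr mulr1 [rmax * C]mulrC.
by rewrite (le_lt_trans (ler_wpM2l C0 (ltW rm))) // ltrDl.
Qed.

End AtSimpleZero.

Lemma bifurcation_of_signs l0 : 0 < l0 -> stiffness eps W l0^-1 = 0 ->
  (forall h, 0 < h -> h < l0^-1 -> stiffness eps W h < 0) ->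
  (forall h, l0^-1 < h -> 0 < stiffness eps W h) ->
  bifurcation_point eps W l0.
Proof.
move=> l00 G0 Gm Gp; split => // d d0.
have h00 : 0 < l0^-1 by rewrite invr_gt0.
have ci : {for l0^-1, continuous (fun x : R => x^-1)}.
  by apply: inv_continuous; exact: lt0r_neq0.
have nr : \forall x \near l0^-1, `|l0 - x^-1| < d.
  by have /cvgrPdist_lt /(_ d d0) := ci; rewrite invrK.
move/nbhs_ballP : nr => [delta /= delta0 hdelta].
move: l0^-1 h00 G0 Gm Gp hdelta {ci} => h0 h00 G0 Gm Gp hdelta.
have V20 : V2 h0 < 0.
  have : 0 < eps * pi ^+ 2 * h0 ^+ 2 by rewrite !mulr_gt0 ?exprn_gt0 ?pi_gt0.
  by move: G0; rewrite /stiffness; lra.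
have [r1 r1I hr1] := upper_bound_near (V2_continuous hW h00) h00 (ltac:(lra) : V2 h0 < - (- V2 h0 / 2)).
have [r2 r2I hr2] := lower_bound_near (V2_continuous hW h00) h00 (ltac:(lra) : - (- (2 * V2 h0)) < V2 h0).
pose rho := Num.min r1 r2.
have [rho0 rho1 rho2] : [/\ 0 < rho, rho <= r1 & rho <= r2].
  by rewrite lt_min !ge_min !lexx orbT; case/andP: r1I => ->; case/andP: r2I => ->.
clearbody rho.
have rhoh : rho <= h0 by case/andP: r1I => _; exact: le_trans.
have hm z : h0 - rho < z < h0 + rho -> V2 z <= - (- V2 h0 / 2).
  by move=> zI; apply: hr1; lra.
have hM z : h0 - rho < z < h0 + rho -> - (- (2 * V2 h0)) <= V2 z.
  by move=> zI; apply: hr2; lra.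
have [l [u [lp ll eq nu us]]] := small_equilibrium_exists rho0 rhoh
  (ltac:(lra) : 0 < - V2 h0 / 2) hm hM d0 delta0 Gm Gp.
exists l, u; split => //.
by rewrite distrC -[l]invrK; apply: hdelta; rewrite /ball /= distrC.
Qed.

End Bifurcation.

Theorem proposition4p6 (R : realType) (W : R -> R) (gam kap eps : R)
    (lam : nat -> R)
    (hW : stored_energy W gam kap)
    (heps : 0 < eps)
    (hlam_gt0 : forall n : nat, (0 < n)%N -> 0 < lam n)
    (hlam_root : forall n : nat, (0 < n)%N -> char_eq eps W n (lam n))
    (hlam_unique : forall n : nat, (0 < n)%N ->
       forall x : R, 0 < x -> char_eq eps W n x -> x = lam n)
    (hlam_transversal : forall n : nat, (0 < n)%N ->
       char_transversal eps W n (lam n))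
    (hlam_kap : kap^-1 < lam 1%N)
    (hlam_incr : forall n : nat, (0 < n)%N -> lam n < lam n.+1) :
  [/\ forall l : R, 0 < l -> l < lam 1%N ->
        locally_stable eps W l (fun=> 0),
      forall l : R, lam 1%N < l -> unstable eps W l (fun=> 0) &
      first_bifurcation_point eps W (lam 1%N)].
Proof.
have l10 := hlam_gt0 1%N isT.
have root := hlam_root 1%N isT.
have uniq := hlam_unique 1%N isT.
have trans := hlam_transversal 1%N isT.
have Gp l : 0 < l -> l < lam 1%N -> 0 < stiffness eps W l^-1.
  move=> l0 ll; apply: (stiffness_gt0 hW heps l10 root uniq trans).
  by rewrite ltf_pV2.
split.
- by move=> l l0 ll; exact: (stable_of_stiffness hW heps l0 (Gp l l0 ll)).
- move=> l ll; have l0 := lt_trans l10 ll.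
  apply: (unstable_of_stiffness hW l0).
  apply: (stiffness_lt0 hW heps l10 root uniq trans); first by rewrite invr_gt0.
  by rewrite ltf_pV2.
- split.
    apply: (bifurcation_of_signs hW heps l10).
    + exact: stiffness_h1.
    + by move=> h h0 hh; exact: (stiffness_lt0 hW heps l10 root uniq trans).
    + by move=> h hh; exact: (stiffness_gt0 hW heps l10 root uniq trans).
  move=> l bl; rewrite leNgt; apply/negP => ll; have [l0 _] := bl.
  exact: (no_small_equilibrium hW heps l0 (Gp l l0 ll) bl).
Qed.
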